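(* Let $R>0$ and let $f$ be a slice preserving regular function in a neighborhood of the closed ball $\overline{\mathbb{B}_{R}}$ such that $f(0)\neq0$ and every zero of $f$ lies in $$C=\{\alpha+I\beta\in\mathbb{H}:\ \beta\geq|\alpha|,\ \beta\neq0,\ I\in\mathbb{S}\}.$$ Then, for $0<r<R$, $$N(r)\leq\frac{\log M(R)-\log|f(0)|-\frac{1}{8}R^2\,\Delta\log|f(x)|_{|x=0}}{\log R-\log r}.$$
   Context: $\mathbb{H}$ denotes the quaternions, identified with $\mathbb{R}^4$, $x^c$ the usual conjugate, $|x|^2=xx^c$, $\mathbb{B}_r=\{|x|<r\}$, $\Delta$ the Laplacian of $\mathbb{R}^4$, $\mathbb{S}=\{I\in\mathbb{H}:I^2=-1\}$, $\mathbb{C}_I=\mathbb{R}+I\mathbb{R}$, $\mathbb{S}_{\alpha+I\beta}=\{\alpha+J\beta:J\in\mathbb{S}\}$. Let $\mathbb{H}_{\mathbb{C}}=\mathbb{H}\otimes_{\mathbb{R}}\mathbb{C}=\{p+\imath q\}$ with product $(p_1+\imath q_1)(p_2+\imath q_2)=p_1p_2-q_1q_2+\imath(p_1q_2+q_1p_2)$ and $\overline{p+\imath q}=p-\imath q$. For an open $D\subseteq\mathbb{C}$ symmetric under conjugation, $\Omega_D=\{\alpha+I\beta:\alpha+i\beta\in D,I\in\mathbb{S}\}$. A stem function is $F=F_1+\imath F_2:D\to\mathbb{H}_{\mathbb{C}}$ with $F(\bar z)=\overline{F(z)}$; it induces the slice function $f=\mathcal{I}(F):\Omega_D\to\mathbb{H}$,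 $f(\alpha+I\beta)=F_1(\alpha+i\beta)+IF_2(\alpha+i\beta)$; $f$ is regular if $F$ is $C^1$ with $\partial F/\partial\alpha+\imath\,\partial F/\partial\beta=0$, and slice preserving if $f(\Omega_D\cap\mathbb{C}_J)\subset\mathbb{C}_J$ for all $J\in\mathbb{S}$ (equivalently $F_1,F_2$ real valued). The symmetrization is $f^s=\mathcal{I}(F^cF)$, with $F^c=F_1^c+\imath F_2^c$ (so $f^s=f^2$ for slice preserving $f$); $(x-q)^s=x^2-x(q+q^c)+qq^c$. The total multiplicity $m_f(q)$ of a zero $q$ is the largest $n$ such that $((x-q)^s)^n$ divides $f^s$ among regular functions. Under the hypotheses, the zeros of $f$ form spheres $\mathbb{S}_a$ with $a$ non-real. $M(R)=\sup_{|x|=R}|f(x)|$, and $N(r)=\sum m_f(x)$, the sum over the zeros of $f$ in $\mathbb{B}_r$, where each sphere $\mathbb{S}_a$ of zeros is counted once (with one representative $a$). *)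

(* Defs.v *)
(* Built on the Stdlib reals and Coquelicot. *)
From Stdlib Require Import Reals List.
From Coquelicot Require Import Coquelicot.
Open Scope R_scope.

(* (a, (b, (c, d))) stands for a + b i + c j + d k; sums, real multiples and
   the topology are those of Coquelicot's product normed modules. *)
Definition quat : Type := (R * (R * (R * R)))%type.

Definition qmul (x y : quat) : quat :=
  let '(a, (b, (c, d))) := x in
  let '(a', (b', (c', d'))) := y in
  (a * a' - b * b' - c * c' - d * d',
   (a * b' + b * a' + c * d' - d * c',
    (a * c' - b * d' + c * a' + d * b',
     a * d' + b * c' - c * b' + d * a'))).

Definition qconj (x : quat) : quat :=
  let '(a, (b, (c, d))) := x in (a, (- b, (- c, - d))).

Definition qreal (a : R) : quat := (a, (0, (0, 0))).

(* |x|^2 = x x^c; this product has vanishing imaginary part. *)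
Definition qnorm (x : quat) : R := sqrt (fst (qmul x (qconj x))).

Definition imag_unit (I : quat) : Prop := qmul I I = qreal (- 1).

Definition slice_point (alpha : R) (I : quat) (beta : R) : quat :=
  plus (qreal alpha) (qmul I (qreal beta)).

Definition slice_plane (J x : quat) : Prop :=
  exists alpha beta : R, x = slice_point alpha J beta.

(* y belongs to the sphere S_x; it is the singleton {x} when x is real. *)
Definition on_sphere (x y : quat) : Prop :=
  exists (alpha beta : R) (I J : quat),
    imag_unit I /\ imag_unit J /\
    x = slice_point alpha I beta /\ y = slice_point alpha J beta.

(* Complexified quaternions: (p, q) stands for p + iota q. *)
Definition HC : Type := (quat * quat)%type.

Definition HCmul (u v : HC) : HC :=
  (minus (qmul (fst u) (fst v)) (qmul (snd u) (snd v)),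
   plus (qmul (fst u) (snd v)) (qmul (snd u) (fst v))).

Definition HCone : HC := (qreal 1, qreal 0).
Definition HCiota : HC := (qreal 0, qreal 1).

Definition HCbar (u : HC) : HC := (fst u, opp (snd u)).

Fixpoint HCpow (u : HC) (n : nat) : HC :=
  match n with
  | O => HCone
  | S k => HCmul u (HCpow u k)
  end.

Definition conj_symmetric (D : C -> Prop) : Prop :=
  forall z : C, D z -> D (Cconj z).

Definition Omega (D : C -> Prop) (x : quat) : Prop :=
  exists (alpha beta : R) (I : quat),
    D (alpha, beta) /\ imag_unit I /\ x = slice_point alpha I beta.

Definition is_stem (D : C -> Prop) (F : C -> HC) : Prop :=
  forall z : C, D z -> F (Cconj z) = HCbar (F z).

(* f restricted to Omega D is the slice function induced by F. *)
Definition induces (D : C -> Prop) (F : C -> HC) (f : quat -> quat) : Prop :=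
  forall (alpha beta : R) (I : quat),
    D (alpha, beta) -> imag_unit I ->
    f (slice_point alpha I beta) =
      plus (fst (F (alpha, beta))) (qmul I (snd (F (alpha, beta)))).

(* Fa and Fb are the partial derivatives of F in alpha and beta. *)
Definition holomorphic_stem (D : C -> Prop) (F : C -> HC) : Prop :=
  exists Fa Fb : C -> HC,
    forall alpha beta : R, D (alpha, beta) ->
      is_derive (fun t : R => F (t, beta)) alpha (Fa (alpha, beta)) /\
      is_derive (fun t : R => F (alpha, t)) beta (Fb (alpha, beta)) /\
      continuous Fa (alpha, beta) /\
      continuous Fb (alpha, beta) /\
      plus (Fa (alpha, beta)) (HCmul HCiota (Fb (alpha, beta))) = zero.

Definition slice_regular (D : C -> Prop) (f : quat -> quat) : Prop :=
  exists F : C -> HC, is_stem D F /\ holomorphic_stem D F /\ induces D F f.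

Definition slice_preserving (D : C -> Prop) (f : quat -> quat) : Prop :=
  forall J x : quat,
    imag_unit J -> Omega D x -> slice_plane J x -> slice_plane J (f x).

(* Stem function F^c F of the symmetrization f^s. *)
Definition symm_stem (F : C -> HC) (z : C) : HC :=
  HCmul (qconj (fst (F z)), qconj (snd (F z))) (F z).

(* Stem function of x |-> x - q. *)
Definition linear_stem (q : quat) (z : C) : HC :=
  (minus (qreal (fst z)) q, qreal (snd z)).

(* ((x - q)^s)^n divides f^s among the regular functions on Omega D. The slice
   product of slice functions is induced by the pointwise product of their stem
   functions, and F is determined on D by f. *)
Definition symm_power_divides
    (D : C -> Prop) (f : quat -> quat) (q : quat) (n : nat) : Prop :=
  exists F G : C -> HC,
    is_stem D F /\ induces D F f /\
    is_stem D G /\ holomorphic_stem D G /\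
    forall z : C, D z ->
      symm_stem F z = HCmul (HCpow (symm_stem (linear_stem q) z) n) (G z).

(* The largest such n, with value p_infty if the set of such n is unbounded. *)
Definition total_multiplicity
    (D : C -> Prop) (f : quat -> quat) (q : quat) : Rbar :=
  Lub_Rbar (fun y => exists n : nat, symm_power_divides D f q n /\ y = INR n).

(* Lists of zeros of f in the open ball of radius r, on distinct spheres. *)
Definition zero_representatives
    (D : C -> Prop) (f : quat -> quat) (r : R) (l : list quat) : Prop :=
  (forall x : quat, In x l -> Omega D x /\ qnorm x < r /\ f x = zero) /\
  ForallOrdPairs (fun x y => ~ on_sphere x y) l.

(* N(r): sum of a family of nonnegative terms, as the supremum of its finite
   partial sums. *)
Definition zero_count (D : C -> Prop) (f : quat -> quat) (r : R) : Rbar :=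
  Rbar_lub (fun y => exists l : list quat,
    zero_representatives D f r l /\
    y = fold_right Rbar_plus (Finite 0) (map (total_multiplicity D f) l)).

Definition max_modulus (f : quat -> quat) (rho : R) : R :=
  real (Lub_Rbar (fun y => exists x : quat, qnorm x = rho /\ y = qnorm (f x))).

Definition laplacian (u : quat -> R) (x : quat) : R :=
  let second_derivative (e : quat) :=
    Derive_n (fun t : R => u (plus x (scal t e))) 2 0 in
  second_derivative (1, (0, (0, 0))) + second_derivative (0, (1, (0, 0))) +
  second_derivative (0, (0, (1, 0))) + second_derivative (0, (0, (0, 1))).

Definition cone (x : quat) : Prop :=
  exists (alpha beta : R) (I : quat),
    imag_unit I /\ Rabs alpha <= beta /\ beta <> 0 /\
    x = slice_point alpha I beta.

(* Main.v *)
Require Import Defs.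
From Stdlib Require Import Reals List Lra Lia Psatz ClassicalEpsilon FinFun.
From Coquelicot Require Import Coquelicot.
Open Scope R_scope.

(** Write f as the holomorphic function F = F_1 + i F_2 of alpha + i beta. The mean of
    log |f| over the 3-sphere of radius R is the mean of (1 - cos 2 th) log |F (R e^(i th))|;
    for zero free F it equals log |F 0| - R^2/4 Re (F'/F)'(0), where
    Delta log |f| (0) = - 2 Re (F'/F)'(0). Trading a factor z - w of F^2, |w| < R, for
    R - conj w z / R keeps the modulus on |z| = R, adds log (R / |w|) to log |F^2 (0)|, and
    does not increase Re (log F^2)''(0) because Re w^2 <= 0 on the cone. The quotients
    (F(z) - F(w)) / (z - w) are holomorphic since F is a Cauchy transform. *)

(** The removal of zeros is carried out on H = F^2 because this is the stem function of f^s, and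
    m_f(q) counts the powers of (x - q)^s in f^s. Such a power is (z - w)(z - conj w) with w = alpha
    + i beta, so a sphere of multiplicity n puts n factors into H at w and n more at conj w. The
    resulting factor 2 cancels against log |F^2| = 2 log |F|. The constant 1/8 arises as follows:
    integrating the t-derivative -(t/2) Re (F'/F)'(0) of the weighted mean gives R^2/4, and the
    Laplacian contributes 1 - 3 = -2, one unit from the real axis and minus one from each imaginary
    axis. The obstacle is the zeros that N(r) does not count. Those with r <= |z| < R must be
    removed as well before the identity for zero free functions applies, and those with |z| = R
    cannot be removed at all. The uncounted zeros are therefore removed only inside a disc of radius
    p < R, with their gain thrown away. The mean is taken on a circle of radius t < p, the maximum
    principle carries the bound M(R) inwards, and t tends to R at the end. *)

Local Arguments Cmod _%_C_scope.
Local Arguments Re _%_C_scope.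
Local Arguments Im _%_C_scope.
Local Bind Scope C_scope with C.

(* Makes [ring] and [field] see through the coercions of Coquelicot's structures on C. *)
Ltac as_C :=
  repeat match goal with x : UniformSpace.sort C_UniformSpace |- _ => change C in x end;
  match goal with |- @eq _ ?a ?b => change (@eq C a b) end.
Ltac cring := as_C; ring.
Ltac cfield := as_C; field.

(** * Continuity of complex-valued maps *)

Lemma continuous_pair_iff {U : UniformSpace} (f : U -> C) (x : U) :
  continuous f x <->
  continuous (fun y => fst (f y)) x /\ continuous (fun y => snd (f y)) x.
Proof.
  split.
  - intros H; split.
    + apply (continuous_comp f (fun p : C => fst p)); [exact H | apply continuous_fst].
    + apply (continuous_comp f (fun p : C => snd p)); [exact H | apply continuous_snd].
  - intros [H1 H2].
    apply (continuous_ext (fun y => (fst (f y), snd (f y)))).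
    + intros y; now destruct (f y).
    + apply (continuous_comp_2 (fun y => fst (f y)) (fun y => snd (f y)) (fun a b : R => (a, b))); auto.
      apply (continuous_ext (fun p : R * R => p)).
      * now intros [a b].
      * apply continuous_id.
Qed.

Lemma continuous_Cplus {U : UniformSpace} (f g : U -> C) (x : U) :
  continuous f x -> continuous g x -> continuous (fun y => Cplus (f y) (g y)) x.
Proof.
  rewrite !continuous_pair_iff; simpl; intros [H1 H2] [H3 H4]; split.
  - exact (continuous_plus (V := R_NormedModule) _ _ x H1 H3).
  - exact (continuous_plus (V := R_NormedModule) _ _ x H2 H4).
Qed.

Lemma continuous_Cmult {U : UniformSpace} (f g : U -> C) (x : U) :
  continuous f x -> continuous g x -> continuous (fun y => Cmult (f y) (g y)) x.
Proof.
  rewrite !continuous_pair_iff; simpl; intros [H1 H2] [H3 H4]; split.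
  - apply (continuous_minus (V := R_NormedModule)); apply (continuous_mult (K := R_AbsRing)); auto.
  - apply (continuous_plus (V := R_NormedModule)); apply (continuous_mult (K := R_AbsRing)); auto.
Qed.

Lemma continuous_Copp {U : UniformSpace} (f : U -> C) (x : U) :
  continuous f x -> continuous (fun y => Copp (f y)) x.
Proof.
  rewrite !continuous_pair_iff; simpl; intros [H1 H2]; split;
  apply (continuous_opp (V := R_NormedModule)); auto.
Qed.

Lemma continuous_Cminus {U : UniformSpace} (f g : U -> C) (x : U) :
  continuous f x -> continuous g x -> continuous (fun y => Cminus (f y) (g y)) x.
Proof. intros H1 H2; apply continuous_Cplus; auto; now apply continuous_Copp. Qed.

Lemma continuous_Cconj {U : UniformSpace} (f : U -> C) (x : U) :
  continuous f x -> continuous (fun y => Cconj (f y)) x.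
Proof.
  rewrite !continuous_pair_iff; simpl; intros [H1 H2]; split; auto.
  apply (continuous_opp (V := R_NormedModule)); auto.
Qed.

Lemma continuous_Rinv_cmp {U : UniformSpace} (f : U -> R) (x : U) :
  continuous f x -> f x <> 0 -> continuous (fun y => / f y) x.
Proof.
  intros H1 H2; apply (continuous_comp f Rinv); auto.
  now apply continuous_Rinv.
Qed.

Lemma continuous_Cinv {U : UniformSpace} (f : U -> C) (x : U) :
  continuous f x -> f x <> RtoC 0 -> continuous (fun y => Cinv (f y)) x.
Proof.
  intros H H0; generalize H; rewrite !continuous_pair_iff; simpl; intros [H1 H2].
  assert (Hd : fst (f x) ^ 2 + snd (f x) ^ 2 <> 0).
  { intros E; apply H0. destruct (f x) as [a b]; simpl in *.
    assert (a = 0) by nra. assert (b = 0) by nra. now subst. }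
  assert (Hc : continuous (fun y => / (fst (f y) ^ 2 + snd (f y) ^ 2)) x).
  { apply (continuous_Rinv_cmp (fun y => fst (f y) ^ 2 + snd (f y) ^ 2)); auto.
    simpl.
    apply (continuous_plus (V := R_NormedModule)); apply (continuous_mult (K := R_AbsRing)); auto;
    apply (continuous_mult (K := R_AbsRing)); auto; apply continuous_const. }
  split; apply (continuous_mult (K := R_AbsRing)); auto.
  apply (continuous_opp (V := R_NormedModule)); auto.
Qed.

Lemma continuous_Cdiv {U : UniformSpace} (f g : U -> C) (x : U) :
  continuous f x -> continuous g x -> g x <> RtoC 0 -> continuous (fun y => Cdiv (f y) (g y)) x.
Proof. intros; apply continuous_Cmult; auto; now apply continuous_Cinv. Qed.

Lemma continuous_Cpow {U : UniformSpace} (f : U -> C) (n : nat) (x : U) :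
  continuous f x -> continuous (fun y => Cpow (f y) n) x.
Proof.
  intros H; induction n as [|n IH]; simpl.
  - apply continuous_const.
  - now apply continuous_Cmult.
Qed.

Lemma continuous_RtoC {U : UniformSpace} (f : U -> R) (x : U) :
  continuous f x -> continuous (fun y => RtoC (f y)) x.
Proof.
  intros H; apply continuous_pair_iff; split; simpl; auto; apply continuous_const.
Qed.

Lemma continuous_Re {U : UniformSpace} (f : U -> C) (x : U) :
  continuous f x -> continuous (fun y => Re (f y)) x.
Proof. intros H; now apply continuous_pair_iff in H. Qed.

Lemma continuous_Im {U : UniformSpace} (f : U -> C) (x : U) :
  continuous f x -> continuous (fun y => Im (f y)) x.
Proof. intros H; now apply continuous_pair_iff in H. Qed.

Lemma continuous_Cmod {U : UniformSpace} (f : U -> C) (x : U) :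
  continuous f x -> continuous (fun y => Cmod (f y)) x.
Proof.
  intros H; apply continuous_pair_iff in H; destruct H as [H1 H2].
  unfold Cmod. apply (continuous_comp (fun y => fst (f y) ^ 2 + snd (f y) ^ 2) sqrt).
  - simpl.
    apply (continuous_plus (V := R_NormedModule)); apply (continuous_mult (K := R_AbsRing)); auto;
    apply (continuous_mult (K := R_AbsRing)); auto; apply continuous_const.
  - apply continuous_sqrt.
Qed.

(** Neighbourhoods in C come from the product structure, whose balls are squares; this passes to
    round discs, and the radius d / 2 pays for |w| <= |Re w| + |Im w|. *)
Lemma locally_Cmod (z : C) (P : C -> Prop) :
  locally z P <-> exists d : R, 0 < d /\ forall w : C, Cmod (w - z) < d -> P w.
Proof.
  split.
  - intros [d Hd]; exists d; split; [apply cond_pos|]. intros w Hw; apply Hd.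
    pose proof (Rmax_Cmod (w - z)%C) as Hm.
    destruct w as [a b], z as [a' b']; simpl in *.
    split; unfold ball; simpl; unfold AbsRing_ball, abs, minus, plus, opp; simpl;
    unfold Rmax in Hm; destruct Rle_dec in Hm; lra.
  - intros [d [Hd HP]]. assert (Hd' : 0 < d / 2) by lra.
    exists (mkposreal _ Hd'). intros w [H1 H2]; apply HP.
    destruct w as [a b], z as [a' b'].
    unfold ball in H1, H2; simpl in H1, H2; unfold AbsRing_ball, abs, minus, plus, opp in H1, H2; simpl in H1, H2.
    apply Rle_lt_trans with (Cmod (RtoC (a - a')) + Cmod (Ci * RtoC (b - b'))).
    + replace (((a, b) - (a', b'))%C) with (RtoC (a - a') + Ci * RtoC (b - b'))%C.
      * apply Cmod_triangle.
      * apply injective_projections; simpl; ring.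
    + rewrite Cmod_mult, Cmod_Ci, !Cmod_R. unfold Rminus. lra.
Qed.

Lemma continuous_eps {U : UniformSpace} (f : U -> C) (x : U) :
  continuous f x <-> forall eps : R, 0 < eps -> locally x (fun y => Cmod (f y - f x) < eps).
Proof.
  split.
  - intros H eps He. apply (H (fun w => Cmod (w - f x) < eps)).
    apply locally_Cmod. exists eps; auto.
  - intros H P HP. apply locally_Cmod in HP. destruct HP as [d [Hd HP]].
    unfold filtermap. generalize (H d Hd). apply filter_imp. intros y; apply HP.
Qed.

Lemma locally_disc (z : C) (r : R) : Cmod z < r -> locally z (fun w => Cmod w < r).
Proof.
  intros H; apply locally_Cmod; exists (r - Cmod z); split; [lra|].
  intros w Hw. replace w with ((w - z) + z)%C by ring.
  apply Rle_lt_trans with (1 := Cmod_triangle _ _); lra.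
Qed.

Lemma Cmod_triangle_rev (z w : C) : Cmod z - Cmod w <= Cmod (z - w).
Proof.
  pose proof (Cmod_triangle (z - w) w) as H. replace (z - w + w)%C with z in H by ring. lra.
Qed.

Lemma Re_le_Cmod (z : C) : Re z <= Cmod z.
Proof. pose proof (re_le_Cmod z); pose proof (Rle_abs (Re z)); lra. Qed.

(** * Complex derivatives *)

(* Caratheodory's form of differentiability makes the product, quotient and
   chain rules algebraic identities. *)
Definition Cder (g : C -> C) (z l : C) : Prop :=
  exists q : C -> C, continuous q z /\ q z = l /\
    locally z (fun w => g w = g z + q w * (w - z))%C.

Lemma Cder_continuous (g : C -> C) (z l : C) : Cder g z l -> continuous g z.
Proof.
  intros [q [Hq [_ H]]].
  apply (continuous_ext_loc _ (fun w => g z + q w * (w - z))%C).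
  - generalize H; apply filter_imp; now intros w ->.
  - apply continuous_Cplus; [apply continuous_const|].
    apply continuous_Cmult; auto. apply continuous_Cminus; [apply continuous_id | apply continuous_const].
Qed.

Lemma Cder_ext_loc (f g : C -> C) (z l : C) :
  locally z (fun w => f w = g w) -> Cder f z l -> Cder g z l.
Proof.
  intros H [q [Hq [Hl Hf]]]; exists q; repeat split; auto.
  pose proof (locally_singleton _ _ H) as Hz.
  generalize (filter_and _ _ H Hf); apply filter_imp.
  intros w [H1 H2]; rewrite <- H1, <- Hz; exact H2.
Qed.

Lemma Cder_const (c z : C) : Cder (fun _ => c) z 0.
Proof.
  exists (fun _ => RtoC 0); repeat split; try apply continuous_const.
  apply filter_forall; intros; cring.
Qed.

Lemma Cder_id (z : C) : Cder (fun w => w) z 1.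
Proof.
  exists (fun _ => RtoC 1); repeat split; try apply continuous_const.
  apply filter_forall; intros; cring.
Qed.

Lemma Cder_plus (f g : C -> C) (z l m : C) :
  Cder f z l -> Cder g z m -> Cder (fun w => f w + g w)%C z (l + m).
Proof.
  intros [p [Hp [<- Hf]]] [q [Hq [<- Hg]]].
  exists (fun w => p w + q w)%C; repeat split.
  - now apply continuous_Cplus.
  - generalize (filter_and _ _ Hf Hg); apply filter_imp.
    intros w [-> ->]; cring.
Qed.

Lemma Cder_mult (f g : C -> C) (z l m : C) :
  Cder f z l -> Cder g z m -> Cder (fun w => f w * g w)%C z (l * g z + f z * m).
Proof.
  intros Df Dg. pose proof (Cder_continuous _ _ _ Dg) as Cg.
  destruct Df as [p [Hp [<- Hf]]], Dg as [q [Hq [<- Hg]]].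
  exists (fun w => p w * g w + f z * q w)%C; repeat split.
  - apply continuous_Cplus; apply continuous_Cmult; auto. apply continuous_const.
  - generalize (filter_and _ _ Hf Hg); apply filter_imp.
    intros w [-> ->]; cring.
Qed.

Lemma locally_neq_0 {U : UniformSpace} (f : U -> C) (x : U) :
  continuous f x -> f x <> RtoC 0 -> locally x (fun y => f y <> RtoC 0).
Proof.
  intros Hf H0. apply Cmod_gt_0 in H0.
  generalize (proj1 (continuous_eps f x) Hf _ H0). apply filter_imp.
  intros y Hy E; rewrite E in Hy.
  replace (0 - f x)%C with (- f x)%C in Hy by ring. rewrite Cmod_opp in Hy; lra.
Qed.

Lemma Cder_inv (f : C -> C) (z l : C) :
  Cder f z l -> f z <> RtoC 0 -> Cder (fun w => / f w)%C z (- l / (f z * f z)).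
Proof.
  intros Df H0. pose proof (Cder_continuous _ _ _ Df) as Cf.
  destruct Df as [p [Hp [<- Hf]]].
  exists (fun w => - p w / (f w * f z))%C; repeat split.
  - apply continuous_Cdiv.
    + now apply continuous_Copp.
    + apply continuous_Cmult; auto. apply continuous_const.
    + now apply Cmult_neq_0.
  - generalize (filter_and _ _ Hf (locally_neq_0 f z Cf H0)); apply filter_imp.
    intros w [E Hw].
    assert (E2 : (p w * (w - z) = f w - f z)%C) by (rewrite E; ring).
    replace (- p w / (f w * f z) * (w - z))%C with (- (p w * (w - z)) / (f w * f z))%C
      by (field; split; auto).
    rewrite E2. field; split; auto.
Qed.

Lemma Cder_comp (f g : C -> C) (z l m : C) :
  Cder f z l -> Cder g (f z) m -> Cder (fun w => g (f w)) z (m * l).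
Proof.
  intros Df [q [Hq [Eq Hg]]]. pose proof (Cder_continuous _ _ _ Df) as Cf.
  destruct Df as [p [Hp [<- Hf]]].
  exists (fun w => q (f w) * p w)%C; repeat split.
  - apply continuous_Cmult; auto. now apply (continuous_comp f q).
  - now rewrite Eq.
  - generalize (filter_and _ _ Hf (Cf _ Hg)); apply filter_imp.
    intros w [E1 E2]. rewrite E2. rewrite E1 at 2; ring.
Qed.

(** The bridge from the algebraic form to the little-o form, which is the one shared with real
    differentiability in two variables. In the converse, q is the difference quotient with the value
    l filled in at z. *)
Lemma Cder_eps (g : C -> C) (z l : C) :
  Cder g z l <->
  forall eps : R, 0 < eps ->
    locally z (fun w => Cmod (g w - g z - l * (w - z)) <= eps * Cmod (w - z)).
Proof.
  split.
  - intros [q [Hq [<- Hg]]] eps He.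
    generalize (filter_and _ _ Hg (proj1 (continuous_eps q z) Hq eps He)).
    apply filter_imp. intros w [-> Hw].
    replace (g z + q w * (w - z) - g z - q z * (w - z))%C with ((q w - q z) * (w - z))%C by ring.
    rewrite Cmod_mult. apply Rmult_le_compat_r; [apply Cmod_ge_0 | lra].
  - intros H.
    exists (fun w => if Ceq_dec w z then l else (g w - g z) / (w - z))%C.
    repeat split.
    + apply continuous_eps. intros eps He.
      assert (He2 : 0 < eps / 2) by lra.
      generalize (H _ He2). apply filter_imp. intros w Hw.
      destruct (Ceq_dec z z) as [_|]; [|easy].
      destruct (Ceq_dec w z) as [->|Hn].
      * replace (l - l)%C with (RtoC 0) by ring. rewrite Cmod_0; lra.
      * assert (Hn' : (w - z)%C <> RtoC 0) by now apply Cminus_eq_contra.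
        replace ((g w - g z) / (w - z) - l)%C with ((g w - g z - l * (w - z)) / (w - z))%C
          by (field; auto).
        rewrite Cmod_div by auto. apply Cmod_gt_0 in Hn'.
        apply Rle_lt_trans with (eps / 2); [|lra].
        apply Rmult_le_reg_r with (1 := Hn'). unfold Rdiv at 1.
        rewrite Rmult_assoc, Rinv_l by lra. lra.
    + now destruct (Ceq_dec z z).
    + apply filter_forall. intros w. destruct (Ceq_dec w z) as [->|Hn].
      * ring.
      * field. now apply Cminus_eq_contra.
Qed.

(** Multiplication by l is the real matrix with rows (Re l, - Im l) and (Im l, Re l): these are the
    Cauchy-Riemann equations. *)
Lemma Cder_differentiable (g : C -> C) (x y : R) (l : C) :
  Cder g (x, y) l ->
  differentiable_pt_lim (fun a b => Re (g (a, b))) x y (Re l) (- Im l) /\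
  differentiable_pt_lim (fun a b => Im (g (a, b))) x y (Im l) (Re l).
Proof.
  intros H.
  assert (K : forall eps : posreal, locally_2d (fun u v =>
    Cmod (g (u, v) - g (x, y) - l * ((u, v) - (x, y))) <=
      eps * Rmax (Rabs (u - x)) (Rabs (v - y))) x y).
  { intros eps. apply locally_2d_locally.
    assert (He : 0 < eps / 2) by (pose proof (cond_pos eps); lra).
    generalize (proj1 (Cder_eps _ _ _) H _ He). apply filter_imp.
    intros [u v] Hw. simpl. apply Rle_trans with (1 := Hw).
    pose proof (Cmod_2Rmax ((u, v) - (x, y))%C) as Hm. simpl in Hm.
    assert (sqrt 2 <= 2) by (rewrite <- (sqrt_Rsqr 2) at 2 by lra; apply sqrt_le_1_alt; unfold Rsqr; lra).
    unfold Rminus.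
    assert (0 <= Rmax (Rabs (u + - x)) (Rabs (v + - y))).
    { apply Rle_trans with (2 := Rmax_l _ _); apply Rabs_pos. }
    assert (Cmod ((u, v) - (x, y)) <= 2 * Rmax (Rabs (u + - x)) (Rabs (v + - y))) by nra.
    nra. }
  split; intros eps; generalize (K eps); apply locally_2d_impl, locally_2d_forall;
  intros u v Huv; apply Rle_trans with (2 := Huv).
  - apply Rle_trans with (2 := re_le_Cmod _). right; f_equal. destruct l; unfold Re, Im; simpl; ring.
  - apply Rle_trans with (2 := Rmax_Cmod _). apply Rle_trans with (2 := Rmax_r _ _).
    right; f_equal. destruct l; unfold Re, Im; simpl; ring.
Qed.

Lemma differentiable_Cder (g : C -> C) (x y : R) (l : C) :
  differentiable_pt_lim (fun a b => Re (g (a, b))) x y (Re l) (- Im l) ->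
  differentiable_pt_lim (fun a b => Im (g (a, b))) x y (Im l) (Re l) ->
  Cder g (x, y) l.
Proof.
  intros H1 H2. apply Cder_eps. intros eps He.
  assert (He2 : 0 < eps / 2) by lra.
  pose proof (H1 (mkposreal _ He2)) as K1. pose proof (H2 (mkposreal _ He2)) as K2.
  apply locally_2d_locally in K1. apply locally_2d_locally in K2.
  generalize (filter_and _ _ K1 K2). apply filter_imp. intros [u v]. simpl fst; simpl snd; simpl pos.
  intros [A1 A2].
  set (w := (g (u, v) - g (x, y) - l * ((u, v) - (x, y)))%C).
  pose proof (Rmax_Cmod ((u, v) - (x, y))%C) as Hm. simpl in Hm. unfold Rminus in A1, A2.
  assert (B1 : Rabs (Re w) <= eps / 2 * Cmod ((u, v) - (x, y))).
  { replace (Re w) with (Re (g (u, v)) + - Re (g (x, y)) + - (Re l * (u + - x) + - Im l * (v + - y)))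
      by (unfold w; destruct l; unfold Re, Im; simpl; ring).
    apply Rle_trans with (1 := A1). apply Rmult_le_compat_l; [lra | exact Hm]. }
  assert (B2 : Rabs (Im w) <= eps / 2 * Cmod ((u, v) - (x, y))).
  { replace (Im w) with (Im (g (u, v)) + - Im (g (x, y)) + - (Im l * (u + - x) + Re l * (v + - y)))
      by (unfold w; destruct l; unfold Re, Im; simpl; ring).
    apply Rle_trans with (1 := A2). apply Rmult_le_compat_l; [lra | exact Hm]. }
  replace w with (RtoC (Re w) + Ci * RtoC (Im w))%C
    by (apply injective_projections; simpl; ring).
  apply Rle_trans with (1 := Cmod_triangle _ _).
  rewrite Cmod_mult, Cmod_Ci, !Cmod_R. lra.
Qed.

(* A total derivative: it is the complex derivative as soon as there is one. *)
Definition Cd (g : C -> C) (z : C) : C :=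
  (Derive (fun t => Re (g (z + RtoC t))) 0, Derive (fun t => Im (g (z + RtoC t))) 0)%C.

Definition is_Cderive (u : R -> C) (t : R) (l : C) : Prop :=
  is_derive (fun x => Re (u x)) t (Re l) /\ is_derive (fun x => Im (u x)) t (Im l).

(** The chain rule along real curves. Every integrand below is a holomorphic function on a segment
    or a circle, so this is how its derivatives in t and th are found. *)
Lemma Cder_curve (g : C -> C) (u : R -> C) (t : R) (l m : C) :
  is_Cderive u t m -> Cder g (u t) l -> is_Cderive (fun x => g (u x)) t (l * m).
Proof.
  intros [U1 U2] H. rewrite (surjective_pairing (u t)) in H.
  destruct (Cder_differentiable _ _ _ _ H) as [D1 D2].
  apply is_derive_Reals in U1. apply is_derive_Reals in U2.
  split; apply is_derive_Reals.
  - replace (Re (l * m)) with (Re l * Re m + - Im l * Im m) by (destruct l, m; unfold Re, Im; simpl; ring).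
    pose proof (derivable_pt_lim_comp_2d (fun a b => Re (g (a, b))) (fun x => Re (u x)) (fun x => Im (u x)) t _ _ _ _ D1 U1 U2) as K.
    intros e He; destruct (K e He) as [d Hd]; exists d; intros h Hh1 Hh2.
    specialize (Hd h Hh1 Hh2). cbv beta in Hd.
    now rewrite (surjective_pairing (u (t + h))), (surjective_pairing (u t)).
  - replace (Im (l * m)) with (Im l * Re m + Re l * Im m) by (destruct l, m; unfold Re, Im; simpl; ring).
    pose proof (derivable_pt_lim_comp_2d (fun a b => Im (g (a, b))) (fun x => Re (u x)) (fun x => Im (u x)) t _ _ _ _ D2 U1 U2) as K.
    intros e He; destruct (K e He) as [d Hd]; exists d; intros h Hh1 Hh2.
    specialize (Hd h Hh1 Hh2). cbv beta in Hd.
    now rewrite (surjective_pairing (u (t + h))), (surjective_pairing (u t)).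
Qed.

Lemma is_Cderive_affine (a c : C) (t : R) : is_Cderive (fun x => a + RtoC x * c)%C t c.
Proof.
  destruct a, c; split; simpl; auto_derive; auto; ring.
Qed.

Lemma Cd_unique (g : C -> C) (z l : C) : Cder g z l -> Cd g z = l.
Proof.
  intros H. pose proof (is_Cderive_affine z 1 0) as K.
  assert (E : (z + RtoC 0 * 1)%C = z) by ring. rewrite <- E in H at 1.
  destruct (Cder_curve g _ _ _ _ K H) as [D1 D2].
  replace (l * 1)%C with l in D1, D2 by ring.
  unfold Cd. rewrite (surjective_pairing l). f_equal; apply is_derive_unique.
  - apply is_derive_ext with (2 := D1). intros t; simpl. do 2 f_equal. ring.
  - apply is_derive_ext with (2 := D2). intros t; simpl. do 2 f_equal. ring.
Qed.

Lemma Cd_ext_loc (f g : C -> C) (z : C) :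
  locally z (fun w => f w = g w) -> Cd f z = Cd g z.
Proof.
  intros H. apply locally_Cmod in H. destruct H as [d [Hd H]].
  unfold Cd; f_equal; apply Derive_ext_loc; exists (mkposreal d Hd); intros t Ht;
  rewrite H; auto; replace (z + RtoC t - z)%C with (RtoC t) by ring; rewrite Cmod_R;
  unfold ball in Ht; simpl in Ht; unfold AbsRing_ball, abs, minus, plus, opp in Ht; simpl in Ht;
  now replace t with (t + - 0) by ring.
Qed.

(** * Holomorphic functions on discs about the origin *)

(** Continuity of the derivative is built in because Cauchy's formula is obtained by differentiating
    under the integral sign; regular stem functions are of class C^1 by definition. *)
Definition Hol (r : R) (g : C -> C) : Prop :=
  forall z : C, Cmod z < r -> Cder g z (Cd g z) /\ continuous (Cd g) z.

Lemma Hol_intro (r : R) (g g' : C -> C) :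
  (forall z : C, Cmod z < r -> Cder g z (g' z)) ->
  (forall z : C, Cmod z < r -> continuous g' z) -> Hol r g.
Proof.
  intros H1 H2 z Hz. rewrite (Cd_unique _ _ _ (H1 z Hz)). split; auto.
  apply continuous_ext_loc with (2 := H2 z Hz).
  generalize (locally_disc z r Hz). apply filter_imp. intros w Hw. symmetry.
  now apply Cd_unique, H1.
Qed.

Lemma Hol_continuous (r : R) (g : C -> C) (z : C) :
  Hol r g -> Cmod z < r -> continuous g z.
Proof. intros H Hz; apply (Cder_continuous g z (Cd g z)); now apply H. Qed.

Lemma Hol_le (r s : R) (g : C -> C) : s <= r -> Hol r g -> Hol s g.
Proof. intros H1 H2 z Hz; apply H2; lra. Qed.

Lemma Hol_ext (r : R) (f g : C -> C) :
  (forall z, Cmod z < r -> f z = g z) -> Hol r f -> Hol r g.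
Proof.
  intros E H. apply (Hol_intro r g (Cd f)).
  - intros z Hz. apply Cder_ext_loc with f; [|now apply H].
    generalize (locally_disc z r Hz). apply filter_imp; auto.
  - intros z Hz; now apply H.
Qed.

(** An integral over the circle of radius s represents a function only inside that circle; this
    collects such representations for all s < r. *)
Lemma Hol_local (r : R) (g : C -> C) :
  (forall s : R, 0 < s < r -> exists f : C -> C,
     Hol s f /\ forall z, Cmod z < s -> f z = g z) -> Hol r g.
Proof.
  intros H z Hz. pose proof (Cmod_ge_0 z).
  destruct (H ((Cmod z + r) / 2) ltac:(lra)) as [f [Hf E]].
  apply (Hol_ext _ _ _ E Hf). lra.
Qed.

Lemma Hol_const (r : R) (c : C) : Hol r (fun _ => c).
Proof.
  apply (Hol_intro r _ (fun _ => RtoC 0)); intros.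
  - apply Cder_const.
  - apply continuous_const.
Qed.

Lemma Hol_id (r : R) : Hol r (fun z => z).
Proof.
  apply (Hol_intro r _ (fun _ => RtoC 1)); intros.
  - apply Cder_id.
  - apply continuous_const.
Qed.

Lemma Hol_plus (r : R) (f g : C -> C) : Hol r f -> Hol r g -> Hol r (fun z => f z + g z)%C.
Proof.
  intros Hf Hg. apply (Hol_intro r _ (fun z => Cd f z + Cd g z)%C); intros z Hz.
  - apply Cder_plus; [now apply Hf | now apply Hg].
  - apply continuous_Cplus; [now apply Hf | now apply Hg].
Qed.

Lemma Hol_mult (r : R) (f g : C -> C) : Hol r f -> Hol r g -> Hol r (fun z => f z * g z)%C.
Proof.
  intros Hf Hg. apply (Hol_intro r _ (fun z => Cd f z * g z + f z * Cd g z)%C); intros z Hz.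
  - apply Cder_mult; [now apply Hf | now apply Hg].
  - pose proof (Hol_continuous r f z Hf Hz). pose proof (Hol_continuous r g z Hg Hz).
    destruct (Hf z Hz), (Hg z Hz).
    apply continuous_Cplus; apply continuous_Cmult; assumption.
Qed.

Lemma Hol_inv (r : R) (f : C -> C) :
  Hol r f -> (forall z, Cmod z < r -> f z <> RtoC 0) -> Hol r (fun z => / f z)%C.
Proof.
  intros Hf H0. apply (Hol_intro r _ (fun z => - Cd f z / (f z * f z))%C); intros z Hz.
  - apply Cder_inv; [now apply Hf | auto].
  - pose proof (Hol_continuous r f z Hf Hz) as Cf. apply continuous_Cdiv.
    + apply continuous_Copp; now apply Hf.
    + now apply continuous_Cmult.
    + apply Cmult_neq_0; auto.
Qed.

Lemma Hol_pow (r : R) (f : C -> C) (n : nat) : Hol r f -> Hol r (fun z => Cpow (f z) n).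
Proof.
  intros Hf; induction n as [|n IH]; simpl; [apply Hol_const | now apply Hol_mult].
Qed.

Lemma Hol_affine (r : R) (a b : C) : Hol r (fun z => a + b * z)%C.
Proof.
  apply Hol_plus; [apply Hol_const|]. apply Hol_mult; [apply Hol_const | apply Hol_id].
Qed.

Lemma Hol_scale (r s t : R) (f : C -> C) :
  Hol r f -> Rabs t * s <= r -> Hol s (fun z => f (RtoC t * z)%C).
Proof.
  intros Hf Hs.
  assert (K : forall z, Cmod z < s -> 0 < s -> Cmod (RtoC t * z) < r \/ t = 0).
  { intros z Hz Hp. destruct (Req_dec t 0) as [->|Ht]; [now right|left].
    apply Rabs_pos_lt in Ht. rewrite Cmod_mult, Cmod_R. nra. }
  assert (D : forall z, Cder (fun z => RtoC t * z)%C z (RtoC t)).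
  { intros z.
    pose proof (Cder_mult (fun _ => RtoC t) (fun z => z) z _ _ (Cder_const _ _) (Cder_id _)) as D.
    cbv beta in D. replace (0 * z + RtoC t * 1)%C with (RtoC t) in D by ring. exact D. }
  intros z Hz. assert (Hs0 : 0 < s) by (pose proof (Cmod_ge_0 z); lra). revert z Hz.
  (* For t = 0 the hypothesis reduces to 0 <= r, which for r = 0 says nothing of f at 0; the
     composite is then treated as a constant. *)
  destruct (Req_dec t 0) as [Et|Ht].
  - subst t. apply (Hol_ext s (fun _ => f (RtoC 0))); [|apply Hol_const].
    intros z _; f_equal; ring.
  - apply (Hol_intro s _ (fun z => Cd f (RtoC t * z) * RtoC t)%C); intros z Hz.
    + apply (Cder_comp (fun z => RtoC t * z)%C f); auto.
      destruct (K z Hz Hs0); [now apply Hf | easy].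
    + apply continuous_Cmult; [|apply continuous_const].
      apply (continuous_comp (fun z => RtoC t * z)%C (Cd f)).
      * apply continuous_Cmult; [apply continuous_const | apply continuous_id].
      * destruct (K z Hz Hs0); [now apply Hf | easy].
Qed.

(** * Means over circles and Cauchy's formula *)

Definition cis (th : R) : C := (cos th, sin th).

Definition rmean (u : R -> R) : R := RInt u 0 (2 * PI) / (2 * PI).

Definition Cmean (phi : R -> C) : C :=
  (rmean (fun th => Re (phi th)), rmean (fun th => Im (phi th))).

Lemma two_PI_pos : 0 < 2 * PI.
Proof. pose proof PI_RGT_0; lra. Qed.

Lemma ex_RInt_cont (u : R -> R) : (forall th, continuous u th) -> ex_RInt u 0 (2 * PI).
Proof. intros H; apply (ex_RInt_continuous (V := R_CompleteNormedModule)); auto. Qed.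

Lemma rmean_plus (u v : R -> R) :
  (forall th, continuous u th) -> (forall th, continuous v th) ->
  rmean (fun th => u th + v th) = rmean u + rmean v.
Proof.
  intros Hu Hv; unfold rmean.
  pose proof (RInt_plus (V := R_CompleteNormedModule) u v 0 (2 * PI) (ex_RInt_cont u Hu) (ex_RInt_cont v Hv)) as H.
  unfold plus in H; simpl in H. rewrite H. field. pose proof two_PI_pos; lra.
Qed.

Lemma rmean_scal (c : R) (u : R -> R) :
  (forall th, continuous u th) -> rmean (fun th => c * u th) = c * rmean u.
Proof.
  intros Hu; unfold rmean.
  pose proof (RInt_scal (V := R_CompleteNormedModule) u 0 (2 * PI) c (ex_RInt_cont u Hu)) as H.
  unfold scal in H; simpl in H; unfold mult in H; simpl in H. rewrite H.
  field. pose proof two_PI_pos; lra.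
Qed.

Lemma rmean_ext (u v : R -> R) : (forall th, u th = v th) -> rmean u = rmean v.
Proof. intros H; unfold rmean; f_equal; apply RInt_ext; auto. Qed.

Lemma rmean_const (c : R) : rmean (fun _ => c) = c.
Proof.
  unfold rmean. rewrite RInt_const. unfold scal; simpl; unfold mult; simpl.
  field. pose proof PI_RGT_0; lra.
Qed.

Lemma rmean_le (u v : R -> R) :
  (forall th, continuous u th) -> (forall th, continuous v th) ->
  (forall th, 0 <= th <= 2 * PI -> u th <= v th) -> rmean u <= rmean v.
Proof.
  intros Hu Hv H; unfold rmean.
  apply Rmult_le_compat_r.
  - left; apply Rinv_0_lt_compat, two_PI_pos.
  - apply RInt_le; auto using ex_RInt_cont.
    + left; apply two_PI_pos.
    + intros th Hth; apply H; lra.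
Qed.

Lemma Cmean_ext (f g : R -> C) : (forall th, f th = g th) -> Cmean f = Cmean g.
Proof. intros H; unfold Cmean; f_equal; apply rmean_ext; intros; now rewrite H. Qed.

Lemma Cmean_const (c : C) : Cmean (fun _ => c) = c.
Proof. unfold Cmean; rewrite !rmean_const; now destruct c. Qed.

Lemma Cmean_plus (f g : R -> C) :
  (forall th, continuous f th) -> (forall th, continuous g th) ->
  Cmean (fun th => f th + g th)%C = (Cmean f + Cmean g)%C.
Proof.
  intros Hf Hg; apply injective_projections; simpl;
  rewrite <- rmean_plus; auto using continuous_Re, continuous_Im.
Qed.

Lemma Cmean_scal (c : C) (f : R -> C) :
  (forall th, continuous f th) -> Cmean (fun th => c * f th)%C = (c * Cmean f)%C.
Proof.
  intros Hf.
  assert (H1 : forall th, continuous (fun th => Re (f th)) th) by auto using continuous_Re.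
  assert (H2 : forall th, continuous (fun th => Im (f th)) th) by auto using continuous_Im.
  assert (S : forall (k : R) u th, continuous u th -> continuous (fun th : R => k * u th) th).
  { intros k u th Hu. apply (continuous_scal_r k u th Hu). }
  apply injective_projections; simpl.
  - rewrite (rmean_ext _ (fun th => fst c * Re (f th) + (- snd c) * Im (f th)))
      by (intros; unfold Re, Im; simpl; ring).
    rewrite rmean_plus, !rmean_scal by auto. ring.
  - rewrite (rmean_ext _ (fun th => fst c * Im (f th) + snd c * Re (f th)))
      by (intros; unfold Re, Im; simpl; ring).
    rewrite rmean_plus, !rmean_scal by auto. ring.
Qed.

Lemma Cmean_minus (f g : R -> C) :
  (forall th, continuous f th) -> (forall th, continuous g th) ->
  Cmean (fun th => f th - g th)%C = (Cmean f - Cmean g)%C.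
Proof.
  intros Hf Hg.
  rewrite (Cmean_ext _ (fun th => f th + (- (1)) * g th)%C) by (intros; ring).
  rewrite Cmean_plus, Cmean_scal; auto.
  - ring.
  - intros; apply continuous_Cmult; auto; apply continuous_const.
Qed.

Lemma Cmean_conj (f : R -> C) :
  (forall th, continuous f th) -> Cmean (fun th => Cconj (f th)) = Cconj (Cmean f).
Proof.
  intros Hf; apply injective_projections; simpl; auto.
  rewrite (rmean_ext _ (fun th => (- 1) * Im (f th))) by (intros; unfold Re, Im; simpl; ring).
  rewrite rmean_scal; [ring|]. auto using continuous_Im.
Qed.

Lemma Re_Cmean (f : R -> C) : Re (Cmean f) = rmean (fun th => Re (f th)).
Proof. reflexivity. Qed.

(* Rotate the mean onto the positive axis: |m|^2 = Re (conj m m). *)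
Lemma Cmod_Cmean_le (f : R -> C) (M : R) :
  (forall th, continuous f th) -> (forall th, 0 <= th <= 2 * PI -> Cmod (f th) <= M) ->
  Cmod (Cmean f) <= M.
Proof.
  intros Hf HM. set (m := Cmean f).
  assert (H0 : 0 <= M) by (pose proof two_PI_pos; apply Rle_trans with (2 := HM 0 ltac:(lra)); apply Cmod_ge_0).
  assert (E : Cmod m ^ 2 <= Cmod m * M).
  { replace (Cmod m ^ 2) with (Re (Cmean (fun th => Cconj m * f th)%C)).
    - rewrite Re_Cmean, <- (rmean_const (Cmod m * M)).
      apply rmean_le.
      + intros; apply continuous_Re, continuous_Cmult; auto; apply continuous_const.
      + intros; apply continuous_const.
      + intros th Hth. apply Rle_trans with (1 := Re_le_Cmod _).
        rewrite Cmod_mult, Cmod_conj. apply Rmult_le_compat_l; auto; apply Cmod_ge_0.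
    - rewrite Cmean_scal by auto. fold m.
      rewrite Cmod2_alt. destruct m; unfold Re, Im; simpl; ring. }
  pose proof (Cmod_ge_0 m). nra.
Qed.

(** Differentiation under the integral sign. The partial derivative is passed as [Psi], so that its
    joint continuity is checked on an explicit expression and not on [Derive]. *)
Lemma rmean_param (Phi Psi : R -> R -> R) (lo hi : R) :
  (forall t th, lo < t < hi -> is_derive (fun x => Phi x th) t (Psi t th)) ->
  (forall t th, lo < t < hi -> continuous (fun p : R * R => Psi (fst p) (snd p)) (t, th)) ->
  (forall t th, lo < t < hi -> continuous (Phi t) th) ->
  forall t, lo < t < hi -> is_derive (fun x => rmean (Phi x)) t (rmean (Psi t)).
Proof.
  intros H1 H2 H3 t Ht.
  assert (L : locally t (fun x => lo < x < hi)).
  { apply (open_and (fun x => lo < x) (fun x => x < hi)); auto; [apply open_gt | apply open_lt]. }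
  unfold rmean.
  assert (D : is_derive (fun x => RInt (fun th => Phi x th) 0 (2 * PI)) t
                (RInt (fun th => Derive (fun u => Phi u th) t) 0 (2 * PI))).
  { apply is_derive_RInt_param.
    - generalize L; apply filter_imp. intros x Hx th _. eexists; now apply H1.
    - intros th _. apply continuity_2d_pt_filterlim.  cbv beta.
      replace (Derive (fun z : R => Phi z th) t) with (Psi t th)
        by (symmetry; now apply is_derive_unique, H1).
      apply filterlim_ext_loc with (2 := H2 t th Ht).
      destruct L as [d Hd]. exists d. intros [u v] [Hu _]. simpl in *.
      symmetry; apply is_derive_unique, H1. now apply Hd.
    - generalize L; apply filter_imp. intros x Hx. apply ex_RInt_cont. intros; now apply H3. }
  rewrite (RInt_ext _ (Psi t)) in D by (intros th _; apply is_derive_unique, H1, Ht).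
  exact (is_derive_scal_l (fun x => RInt (Phi x) 0 (2 * PI)) t _ (/ (2 * PI)) D).
Qed.

Lemma Cmean_param (Phi Psi : R -> R -> C) (lo hi : R) :
  (forall t th, lo < t < hi -> is_Cderive (fun x => Phi x th) t (Psi t th)) ->
  (forall t th, lo < t < hi -> continuous (fun p : R * R => Psi (fst p) (snd p)) (t, th)) ->
  (forall t th, lo < t < hi -> continuous (Phi t) th) ->
  forall t, lo < t < hi -> is_Cderive (fun x => Cmean (Phi x)) t (Cmean (Psi t)).
Proof.
  intros H1 H2 H3 t Ht; split.
  - apply (rmean_param (fun x th => Re (Phi x th)) (fun x th => Re (Psi x th)) lo hi); auto; intros.
    + now apply H1.
    + apply (continuous_Re (fun p : R * R => Psi (fst p) (snd p))); auto.
    + apply continuous_Re; auto.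
  - apply (rmean_param (fun x th => Im (Phi x th)) (fun x th => Im (Psi x th)) lo hi); auto; intros.
    + now apply H1.
    + apply (continuous_Im (fun p : R * R => Psi (fst p) (snd p))); auto.
    + apply continuous_Im; auto.
Qed.

Lemma Cmean_derivative_periodic (u u' : R -> C) :
  (forall th, is_Cderive u th (u' th)) -> (forall th, continuous u' th) ->
  u (2 * PI) = u 0 -> Cmean u' = 0.
Proof.
  intros H Hc E.
  assert (K : forall v v' : R -> R, (forall th, is_derive v th (v' th)) ->
    (forall th, continuous v' th) -> v (2 * PI) = v 0 -> rmean v' = 0).
  { intros v v' Hv Hv' Ev. unfold rmean.
    rewrite (is_RInt_unique (V := R_CompleteNormedModule) v' 0 (2 * PI) 0).
    - unfold Rdiv; ring.
    - replace 0 with (minus (v (2 * PI)) (v 0)) at 2.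
      + apply (is_RInt_derive (V := R_CompleteNormedModule)); auto.
      + rewrite Ev. unfold minus, plus, opp; simpl; ring. }
  unfold Cmean. rewrite (K (fun th => Re (u th))), (K (fun th => Im (u th))); auto;
  try (intros; apply H); auto using continuous_Re, continuous_Im; now rewrite E.
Qed.

Lemma is_Cderive_0_const (h : R -> C) (a b : R) :
  a < b -> (forall t, a <= t <= b -> is_Cderive h t 0) -> h a = h b.
Proof.
  intros Hab H. apply injective_projections.
  - apply (eq_is_derive (V := R_NormedModule) (fun t => Re (h t)) a b); auto. intros t Ht; now apply H.
  - apply (eq_is_derive (V := R_NormedModule) (fun t => Im (h t)) a b); auto. intros t Ht; now apply H.
Qed.

Lemma continuous_cis (th : R) : continuous cis th.
Proof.
  apply continuous_pair_iff; split; simpl.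
  - apply continuous_cos.
  - apply continuous_sin.
Qed.

Lemma Cmod_cis (th : R) : Cmod (cis th) = 1.
Proof.
  unfold Cmod, cis; simpl. rewrite !Rmult_1_r. pose proof (sin2_cos2 th) as H. unfold Rsqr in H.
  rewrite Rplus_comm, H. apply sqrt_1.
Qed.

Lemma cis_period : cis (2 * PI) = cis 0.
Proof. unfold cis. now rewrite cos_2PI, sin_2PI, cos_0, sin_0. Qed.

Lemma cis_neq_0 (th : R) : cis th <> RtoC 0.
Proof. apply Cmod_gt_0; rewrite Cmod_cis; lra. Qed.

Lemma cis_conj (th : R) : (cis th * Cconj (cis th) = 1)%C.
Proof. rewrite <- Cmod2_conj, Cmod_cis. f_equal; ring. Qed.

Lemma is_Cderive_cis (a c : C) (th : R) :
  is_Cderive (fun x => a + c * cis x)%C th (c * (Ci * cis th)).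
Proof.
  destruct a, c; split; simpl; auto_derive; auto; ring.
Qed.

Lemma Cmean_cis : Cmean cis = 0.
Proof.
  assert (H : Cmean (fun th => Ci * cis th)%C = 0).
  { apply (Cmean_derivative_periodic (fun x => 0 + 1 * cis x)%C).
    - intros th. replace (Ci * cis th)%C with (1 * (Ci * cis th))%C by ring. apply is_Cderive_cis.
    - intros; apply continuous_Cmult; [apply continuous_const | apply continuous_cis].
    - now rewrite cis_period. }
  rewrite Cmean_scal in H by apply continuous_cis.
  replace (Cmean cis) with (- Ci * (Ci * Cmean cis))%C.
  - rewrite H. ring.
  - destruct (Cmean cis); apply injective_projections; simpl; ring.
Qed.

Lemma is_Cderive_scal_r (h : R -> C) (t : R) (l c : C) :
  is_Cderive h t l -> is_Cderive (fun x => h x * c)%C t (l * c).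
Proof.
  intros [H1 H2]; split; simpl.
  - apply (is_derive_minus (V := R_NormedModule) (fun x => fst (h x) * fst c) (fun x => snd (h x) * snd c)).
    + now apply (is_derive_scal_l (fun x => Re (h x)) t (Re l) (Re c)).
    + now apply (is_derive_scal_l (fun x => Im (h x)) t (Im l) (Im c)).
  - apply (is_derive_plus (V := R_NormedModule) (fun x => fst (h x) * snd c) (fun x => snd (h x) * fst c)).
    + now apply (is_derive_scal_l (fun x => Re (h x)) t (Re l) (Im c)).
    + now apply (is_derive_scal_l (fun x => Im (h x)) t (Im l) (Re c)).
Qed.

Lemma circle_minus_neq_0 (s th : R) (a : C) :
  Cmod a < s -> (RtoC s * cis th - a)%C <> RtoC 0.
Proof.
  intros H E. assert (E2 : a = (RtoC s * cis th)%C).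
  { replace a with (RtoC s * cis th - (RtoC s * cis th - a))%C by ring. rewrite E; ring. }
  rewrite E2, Cmod_mult, Cmod_R, Cmod_cis in H. pose proof (Rle_abs s); lra.
Qed.

Lemma continuous_circle (s th : R) : continuous (fun th => RtoC s * cis th)%C th.
Proof. apply continuous_Cmult; [apply continuous_const | apply continuous_cis]. Qed.

Lemma Cmod_circle (s th : R) : 0 <= s -> Cmod (RtoC s * cis th) = s.
Proof. intros H. rewrite Cmod_mult, Cmod_R, Cmod_cis, Rabs_pos_eq; lra. Qed.

(* Contract the circle to the point a: d/dt of the mean of
   g (a + t (zeta - a)) zeta / (zeta - a) is the mean of g' (a + t (zeta - a)) zeta,
   which is (1 / it) times a theta-derivative. *)
Lemma Cauchy_contract (r s : R) (g : C -> C) (a : C) :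
  Hol r g -> Cmod a < s < r ->
  Cmean (fun th => g (RtoC s * cis th) * (RtoC s * cis th / (RtoC s * cis th - a)))%C =
  (g a * Cmean (fun th => RtoC s * cis th / (RtoC s * cis th - a)))%C.
Proof.
  intros Hg Hs. pose proof (Cmod_ge_0 a) as Ha.
  set (K := fun th => (RtoC s * cis th / (RtoC s * cis th - a))%C).
  assert (CK : forall th, continuous K th).
  { intros th. apply continuous_Cdiv.
    - apply continuous_circle.
    - apply continuous_Cminus; [apply continuous_circle | apply continuous_const].
    - now apply circle_minus_neq_0. }
  set (p := fun t th => (a + RtoC t * (RtoC s * cis th - a))%C).
  set (Phi := fun t th => (g (p t th) * K th)%C).
  set (Psi := fun t th => (Cd g (p t th) * (RtoC s * cis th))%C).
  (* Derivatives at t = 0 and t = 1 need room on both sides. On (- d, 1 + d) one has |1 - t| + |t|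
     <= 1 + 2 d, hence |p t th| <= (1 + 2 d) s = (r + s) / 2 < r. *)
  set (d := (r - s) / (4 * s)).
  assert (Hd : 0 < d). { apply Rdiv_lt_0_compat; lra. }
  assert (Hds : d * s = (r - s) / 4) by (unfold d; field; lra).
  assert (Hp : forall t th, - d < t < 1 + d -> Cmod (p t th) < r).
  { intros t th Ht. unfold p.
    replace (a + RtoC t * (RtoC s * cis th - a))%C with (RtoC (1 - t) * a + RtoC t * (RtoC s * cis th))%C
      by (rewrite RtoC_minus; ring).
    apply Rle_lt_trans with (1 := Cmod_triangle _ _).
    rewrite (Cmod_mult (RtoC t)), Cmod_circle, Cmod_mult, !Cmod_R by lra.
    assert (Rabs (1 - t) + Rabs t <= 1 + 2 * d) by (unfold Rabs; repeat destruct Rcase_abs; lra).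
    pose proof (Rabs_pos (1 - t)). pose proof (Rabs_pos t).
    assert (Rabs (1 - t) * Cmod a <= Rabs (1 - t) * s) by (apply Rmult_le_compat_l; lra).
    assert ((Rabs (1 - t) + Rabs t) * s <= (1 + 2 * d) * s) by (apply Rmult_le_compat_r; lra).
    lra. }
  assert (Cp : forall t th, continuous (fun q : R * R => p (fst q) (snd q)) (t, th)).
  { intros t th. apply continuous_Cplus; [apply continuous_const|].
    apply continuous_Cmult.
    - apply continuous_RtoC, continuous_fst.
    - apply continuous_Cminus; [|apply continuous_const].
      apply continuous_Cmult; [apply continuous_const|].
      apply (continuous_comp snd cis); [apply continuous_snd | apply continuous_cis]. }
  assert (Cp1 : forall t th, continuous (p t) th).
  { intros t th. apply continuous_Cplus; [apply continuous_const|].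
    apply continuous_Cmult; [apply continuous_const|].
    apply continuous_Cminus; [apply continuous_circle | apply continuous_const]. }
  assert (CPsi : forall t th, - d < t < 1 + d ->
            continuous (fun q : R * R => Psi (fst q) (snd q)) (t, th)).
  { intros t th Ht. apply continuous_Cmult.
    - apply (continuous_comp (fun q : R * R => p (fst q) (snd q)) (Cd g)); auto.
      apply Hg. now apply Hp.
    - apply (continuous_comp snd (fun th => RtoC s * cis th)%C);
        [apply continuous_snd | apply continuous_circle]. }
  assert (CPsi1 : forall t th, - d < t < 1 + d -> continuous (Psi t) th).
  { intros t th Ht. apply continuous_Cmult; [|apply continuous_circle].
    apply (continuous_comp (p t) (Cd g)); auto. apply Hg; now apply Hp. }
  assert (CPhi : forall t th, - d < t < 1 + d -> continuous (Phi t) th).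
  { intros t th Ht. apply continuous_Cmult; auto.
    apply (continuous_comp (p t) g); auto. apply (Hol_continuous r); auto. }
  assert (DPhi : forall t th, - d < t < 1 + d -> is_Cderive (fun x => Phi x th) t (Psi t th)).
  { intros t th Ht. unfold Phi, Psi.
    replace (Cd g (p t th) * (RtoC s * cis th))%C
      with (Cd g (p t th) * (RtoC s * cis th - a) * K th)%C.
    - apply is_Cderive_scal_r.
      apply (Cder_curve g (fun x => p x th)).
      + apply is_Cderive_affine.
      + apply Hg; now apply Hp.
    - unfold K. field. now apply circle_minus_neq_0. }
  assert (Z : forall t, - d < t < 1 + d -> Cmean (Psi t) = 0).
  { intros t Ht. destruct (Req_dec t 0) as [->|Ht0].
    - rewrite (Cmean_ext _ (fun th => (Cd g a * RtoC s) * cis th)%C).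
      + rewrite Cmean_scal, Cmean_cis by apply continuous_cis. ring.
      + intros th; unfold Psi, p. replace (a + 0 * (RtoC s * cis th - a))%C with a by ring. ring.
    - assert (E : Cmean (fun th => (RtoC t * Ci) * Psi t th)%C = 0).
      { apply (Cmean_derivative_periodic (fun th => g (p t th))).
        - intros th. unfold Psi.
          replace (RtoC t * Ci * (Cd g (p t th) * (RtoC s * cis th)))%C
            with (Cd g (p t th) * (RtoC t * RtoC s * (Ci * cis th)))%C by ring.
          apply (Cder_curve g (p t)).
          + unfold p. pose proof (is_Cderive_cis (a - RtoC t * a) (RtoC t * RtoC s) th) as [D1 D2].
            split.
            * apply is_derive_ext with (2 := D1). intros x; f_equal; ring.
            * apply is_derive_ext with (2 := D2). intros x; f_equal; ring.
          + apply Hg; now apply Hp.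
        - intros th. apply continuous_Cmult; [apply continuous_const | auto].
        - unfold p. now rewrite cis_period. }
      rewrite Cmean_scal in E by auto.
      destruct (Ceq_dec (Cmean (Psi t)) 0) as [|N]; auto.
      exfalso. revert E. apply Cmult_neq_0; auto. apply Cmult_neq_0; [|apply Ci_nz].
      intros E; apply Ht0. now apply RtoC_inj. }
  assert (E : Cmean (Phi 0) = Cmean (Phi 1)).
  { apply (is_Cderive_0_const (fun t => Cmean (Phi t))); [lra|]. intros t Ht.
    assert (Ht' : - d < t < 1 + d) by lra.
    rewrite <- (Z t Ht').
    now apply (Cmean_param Phi Psi (- d) (1 + d)). }
  transitivity (Cmean (Phi 1)); [|transitivity (Cmean (Phi 0)); auto].
  - apply Cmean_ext. intros th; unfold Phi, p, K. f_equal. f_equal. ring.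
  - rewrite <- Cmean_scal by auto. apply Cmean_ext. intros th; unfold Phi, p. f_equal. f_equal. ring.
Qed.

(** At a = 0 the kernel zeta / (zeta - a) is identically 1, so contraction alone gives the result;
    the mean of the kernel for general a is deduced from this case. *)
Lemma mean_value (r s : R) (g : C -> C) :
  Hol r g -> 0 < s < r -> Cmean (fun th => g (RtoC s * cis th))%C = g 0.
Proof.
  intros Hg Hs.
  assert (E : forall th, (RtoC s * cis th / (RtoC s * cis th - 0) = 1)%C).
  { intros th. field. split; [apply cis_neq_0|]. intros E; apply RtoC_inj in E; lra. }
  pose proof (Cauchy_contract r s g 0 Hg) as H. rewrite Cmod_0 in H. specialize (H Hs).
  rewrite (Cmean_ext _ (fun th => g (RtoC s * cis th))%C) in H by (intros; rewrite E; ring).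
  rewrite H, (Cmean_ext _ (fun _ => RtoC 1)) by auto.
  rewrite Cmean_const. ring.
Qed.

(* The conjugate of zeta / (zeta - a) is s^2 / (s^2 - conj a zeta) on |zeta| = s. *)
Lemma Cauchy_kernel_mean (s : R) (a : C) :
  Cmod a < s -> Cmean (fun th => RtoC s * cis th / (RtoC s * cis th - a))%C = 1.
Proof.
  intros Ha. pose proof (Cmod_ge_0 a).
  set (K := fun th => (RtoC s * cis th / (RtoC s * cis th - a))%C).
  assert (CK : forall th, continuous K th).
  { intros th. apply continuous_Cdiv.
    - apply continuous_circle.
    - apply continuous_Cminus; [apply continuous_circle | apply continuous_const].
    - now apply circle_minus_neq_0. }
  set (b := (Cconj a / RtoC (s * s))%C).
  assert (Hss : RtoC s <> RtoC 0) by (intros E; apply RtoC_inj in E; lra).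
  assert (Hb : Cmod b = Cmod a / (s * s)).
  { unfold b. rewrite Cmod_div, Cmod_conj, Cmod_R, Rabs_pos_eq; auto; [nra|].
    intros E; apply RtoC_inj in E; nra. }
  (* The function 1 / (1 - b z) has its pole at modulus s^2 / |a|. This r is the harmonic mean of s
     and s^2 / |a|, hence lies strictly between them, and the formula stays meaningful for a = 0. *)
  set (r := 2 * s * s / (s + Cmod a)).
  assert (Hr : s < r).
  { unfold r. apply Rmult_lt_reg_r with (s + Cmod a); [lra|].
    unfold Rdiv. rewrite Rmult_assoc, Rinv_l by lra. nra. }
  assert (Hbr : forall z, Cmod z < r -> (1 + (- b) * z)%C <> RtoC 0).
  { intros z Hz E.
    assert (E1 : (b * z = 1)%C) by (replace (b * z)%C with (1 - (1 + - b * z))%C by ring; rewrite E; ring).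
    assert (E2 : Cmod b * Cmod z = 1) by (rewrite <- Cmod_mult, E1; apply Cmod_1).
    rewrite Hb in E2. pose proof (Cmod_ge_0 z).
    assert (E3 : Cmod a * Cmod z = s * s).
    { replace (Cmod a * Cmod z) with (Cmod a / (s * s) * Cmod z * (s * s)) by (field; lra).
      rewrite E2; ring. }
    assert (E4 : Cmod z * (s + Cmod a) < 2 * s * s).
    { replace (2 * s * s) with (r * (s + Cmod a)) by (unfold r; field; lra).
      apply Rmult_lt_compat_r; lra. }
    assert (Cmod z < s) by nra. nra. }
  pose proof (mean_value r s (fun z => / (1 + (- b) * z))%C
    (Hol_inv r _ (Hol_affine r 1 (- b)) Hbr) ltac:(lra)) as E.
  cbv beta in E.
  rewrite (Cmean_ext _ (fun th => Cconj (K th))) in E.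
  - rewrite Cmean_conj in E by auto.
    replace (1 + - b * 0)%C with (RtoC 1) in E by ring.
    rewrite <- (Cconj_conj (Cmean K)), E.
    apply injective_projections; simpl; field.
  - intros th. unfold K.
    assert (N : (RtoC s * cis th - a)%C <> RtoC 0) by now apply circle_minus_neq_0.
    assert (N1 : (1 + - b * (RtoC s * cis th))%C <> RtoC 0) by (apply Hbr; rewrite Cmod_circle; lra).
    rewrite Cdiv_conj, Cminus_conj, Cmult_conj by auto.
    replace (Cconj (RtoC s)) with (RtoC s) by (apply injective_projections; simpl; ring).
    assert (N2 : (RtoC s * Cconj (cis th) - Cconj a)%C <> RtoC 0).
    { replace (RtoC s * Cconj (cis th) - Cconj a)%C with (Cconj (RtoC s * cis th - a)).
      - intros E0. apply N. rewrite <- (Cconj_conj (RtoC s * cis th - a)), E0.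
        apply injective_projections; simpl; ring.
      - rewrite Cminus_conj, Cmult_conj. f_equal. f_equal. apply injective_projections; simpl; ring. }
    pose proof (cis_conj th) as Ec.
    set (e := cis th) in *. set (e' := Cconj e) in *. set (a' := Cconj a) in *.
    assert (Eb : (b * (RtoC s * RtoC s) = a')%C) by (unfold b; rewrite RtoC_mult; field; auto).
    assert (He' : e' <> RtoC 0). { intros E0. rewrite E0 in Ec. apply C1_nz. rewrite <- Ec; ring. }
    assert (P : ((1 + - b * (RtoC s * e)) * (RtoC s * e' / (RtoC s * e' - a')) = 1)%C).
    { replace ((1 + - b * (RtoC s * e)) * (RtoC s * e' / (RtoC s * e' - a')))%C
        with ((RtoC s * e' - b * (RtoC s * RtoC s) * (e * e')) / (RtoC s * e' - a'))%C by (field; auto).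
      rewrite Ec, Eb. field; auto. }
    transitivity (/ (1 + - b * (RtoC s * e)) *
      ((1 + - b * (RtoC s * e)) * (RtoC s * e' / (RtoC s * e' - a'))))%C.
    + rewrite P. ring.
    + field; auto.
Qed.

Lemma Cauchy_formula (r s : R) (g : C -> C) (a : C) :
  Hol r g -> Cmod a < s < r ->
  g a = Cmean (fun th => g (RtoC s * cis th) * (RtoC s * cis th / (RtoC s * cis th - a)))%C.
Proof.
  intros Hg Hs. rewrite (Cauchy_contract r s g a Hg Hs), Cauchy_kernel_mean by apply Hs. ring.
Qed.

(** * Cauchy transforms *)

(** The density is arbitrary and absorbs the factor zeta of Cauchy's formula. The class is thus
    closed under divided differences: for k = 1 the divided difference at a is the transform of phi
    / (zeta - a). *)
Definition CT (s : R) (phi : R -> C) (k : nat) (z : C) : C :=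
  Cmean (fun th => phi th * Cpow (/ (RtoC s * cis th - z)) k)%C.

(** Telescoping through u^(k+1) - v^(k+1) = u (u^k - v^k) + (u - v) v^k. The factor A on the left
    replaces an exponent k - 1 on the right, which would misbehave at k = 0. *)
Lemma Cpow_minus_bound (A : R) (u v : C) (k : nat) :
  Cmod u <= A -> Cmod v <= A ->
  A * Cmod (Cpow u k - Cpow v k) <= INR k * A ^ k * Cmod (u - v).
Proof.
  intros Hu Hv. pose proof (Cmod_ge_0 u). induction k as [|k IH].
  - simpl. replace (1 - 1)%C with (RtoC 0) by ring. rewrite Cmod_0; lra.
  - rewrite S_INR. simpl pow.
    replace (Cpow u (S k) - Cpow v (S k))%C
      with (u * (Cpow u k - Cpow v k) + (u - v) * Cpow v k)%C by (simpl; ring).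
    apply Rle_trans with (A * (Cmod u * Cmod (Cpow u k - Cpow v k) + Cmod (u - v) * Cmod v ^ k)).
    + apply Rmult_le_compat_l; [lra|]. rewrite <- Cmod_pow, <- !Cmod_mult. apply Cmod_triangle.
    + pose proof (Cmod_ge_0 (Cpow u k - Cpow v k)). pose proof (Cmod_ge_0 (u - v)).
      assert (Cmod v ^ k <= A ^ k) by (apply pow_incr; split; [apply Cmod_ge_0 | auto]).
      assert (Cmod u * (A * Cmod (Cpow u k - Cpow v k)) <= A * (INR k * A ^ k * Cmod (u - v))).
      { apply Rmult_le_compat; auto. apply Rmult_le_pos; lra. }
      assert (A * (Cmod (u - v) * Cmod v ^ k) <= A * (Cmod (u - v) * A ^ k)).
      { apply Rmult_le_compat_l; [lra|]. now apply Rmult_le_compat_l. }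
      lra.
Qed.

Lemma continuous_kernel (s th : R) (phi : R -> C) (k : nat) (z : C) :
  (forall th, continuous phi th) -> Cmod z < s ->
  continuous (fun th => phi th * Cpow (/ (RtoC s * cis th - z)) k)%C th.
Proof.
  intros Hp Hz. apply continuous_Cmult; auto. apply continuous_Cpow, continuous_Cinv.
  - apply continuous_Cminus; [apply continuous_circle | apply continuous_const].
  - now apply circle_minus_neq_0.
Qed.

Lemma bounded_on_period (phi : R -> C) :
  (forall th, continuous phi th) ->
  exists B, 0 < B /\ forall th, 0 <= th <= 2 * PI -> Cmod (phi th) <= B.
Proof.
  intros H. destruct (continuity_ab_maj (fun th => Cmod (phi th)) 0 (2 * PI)) as [m [Hm _]].
  - left; apply two_PI_pos.
  - intros c _. apply continuity_pt_filterlim. now apply (continuous_Cmod phi).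
  - exists (Cmod (phi m) + 1). pose proof (Cmod_ge_0 (phi m)). split; [lra|].
    intros th Hth; specialize (Hm th Hth); simpl in Hm; lra.
Qed.

(** The transform is Lipschitz at z: for |w - z| < d = (s - |z|) / 2 the kernels are at most 1 / d
    in modulus, and 1/(zeta - w) - 1/(zeta - z) is w - z times the product of the two kernels. The
    summand 1 in [L] only makes it positive. *)
Lemma continuous_CT (s : R) (phi : R -> C) (k : nat) (z : C) :
  (forall th, continuous phi th) -> Cmod z < s -> continuous (CT s phi k) z.
Proof.
  intros Hp Hz. destruct (bounded_on_period phi Hp) as [B [HB Hb]].
  set (d := (s - Cmod z) / 2). assert (Hd : 0 < d) by (unfold d; lra).
  set (A := / d). assert (HA : 0 < A) by now apply Rinv_0_lt_compat.
  assert (Hinv : forall w th, Cmod (w - z) < d -> Cmod (/ (RtoC s * cis th - w)) <= A).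
  { intros w th Hw.
    assert (Hws : Cmod w < s - d).
    { replace w with ((w - z) + z)%C by ring. apply Rle_lt_trans with (1 := Cmod_triangle _ _).
      unfold d in *; lra. }
    rewrite Cmod_inv by (apply circle_minus_neq_0; lra).
    apply Rinv_le_contravar; auto.
    apply Rle_trans with (2 := Cmod_triangle_rev _ _).
    pose proof (Cmod_ge_0 w). rewrite Cmod_circle by lra. lra. }
  apply continuous_eps. intros eps He.
  set (L := B * (INR k * A ^ k * A) + 1).
  assert (HL : 0 < L).
  { unfold L. pose proof (pos_INR k). pose proof (pow_lt A k HA).
    assert (0 <= INR k * A ^ k * A) by (repeat apply Rmult_le_pos; lra). nra. }
  apply locally_Cmod. exists (Rmin d (eps / L)). split.
  { apply Rmin_pos; auto. now apply Rdiv_lt_0_compat. }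
  intros w Hw. assert (Hw1 : Cmod (w - z) < d) by (apply Rlt_le_trans with (1 := Hw), Rmin_l).
  assert (Hw2 : Cmod (w - z) < eps / L) by (apply Rlt_le_trans with (1 := Hw), Rmin_r).
  assert (Hws : Cmod w < s).
  { replace w with ((w - z) + z)%C by ring. apply Rle_lt_trans with (1 := Cmod_triangle _ _).
    unfold d in *; lra. }
  apply Rle_lt_trans with (L * Cmod (w - z)).
  2: { replace eps with (L * (eps / L)) by (field; lra). now apply Rmult_lt_compat_l. }
  unfold CT. rewrite <- Cmean_minus by (intros; now apply continuous_kernel).
  apply Cmod_Cmean_le.
  { intros th. apply continuous_Cminus; now apply continuous_kernel. }
  intros th Hth.
  set (u := (/ (RtoC s * cis th - w))%C). set (v := (/ (RtoC s * cis th - z))%C).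
  assert (Hu : Cmod u <= A) by now apply Hinv.
  assert (Hv : Cmod v <= A).
  { apply Hinv. replace (z - z)%C with (RtoC 0) by ring. now rewrite Cmod_0. }
  replace (phi th * Cpow u k - phi th * Cpow v k)%C with (phi th * (Cpow u k - Cpow v k))%C by ring.
  rewrite Cmod_mult.
  assert (E : (u - v = (w - z) * (u * v))%C).
  { unfold u, v. field; split; now apply circle_minus_neq_0. }
  pose proof (Cpow_minus_bound A u v k Hu Hv) as Hk. rewrite E, !Cmod_mult in Hk.
  pose proof (Cmod_ge_0 (w - z)). pose proof (Cmod_ge_0 u). pose proof (Cmod_ge_0 v).
  assert (Huv : Cmod u * Cmod v <= A * A) by (apply Rmult_le_compat; auto).
  assert (P : 0 <= INR k * A ^ k).
  { apply Rmult_le_pos; [apply pos_INR | left; now apply pow_lt]. }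
  assert (Hk2 : A * Cmod (Cpow u k - Cpow v k) <= A * ((INR k * A ^ k * A) * Cmod (w - z))).
  { apply Rle_trans with (1 := Hk).
    replace (A * (INR k * A ^ k * A * Cmod (w - z))) with (INR k * A ^ k * (Cmod (w - z) * (A * A))) by ring.
    apply Rmult_le_compat_l; auto. apply Rmult_le_compat_l; auto. }
  apply Rmult_le_reg_l in Hk2; auto.
  apply Rle_trans with (B * (INR k * A ^ k * A * Cmod (w - z))).
  - apply Rmult_le_compat; auto; apply Cmod_ge_0.
  - unfold L. lra.
Qed.

(** The difference quotient at z is itself the transform of phi / (zeta - z), so its continuity is
    already known. *)
Lemma CT_der1 (s : R) (phi : R -> C) (z : C) :
  (forall th, continuous phi th) -> Cmod z < s -> Cder (CT s phi 1) z (CT s phi 2 z).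
Proof.
  intros Hp Hz.
  set (phiz := fun th => (phi th * Cpow (/ (RtoC s * cis th - z)) 1)%C).
  assert (Hpz : forall th, continuous phiz th) by (intros; now apply continuous_kernel).
  exists (CT s phiz 1). split; [|split].
  - now apply continuous_CT.
  - apply Cmean_ext. intros th; unfold phiz; simpl. ring.
  - generalize (locally_disc z s Hz). apply filter_imp. intros w Hw. unfold CT.
    rewrite Cmult_comm, <- Cmean_scal by (intros; now apply continuous_kernel).
    rewrite <- Cmean_plus.
    + apply Cmean_ext. intros th. unfold phiz; simpl. field.
      split; now apply circle_minus_neq_0.
    + intros; now apply continuous_kernel.
    + intros; apply continuous_Cmult; [apply continuous_const | now apply continuous_kernel].
Qed.

(** With u = 1/(zeta - w) and v = 1/(zeta - z), u^2 - v^2 = (w - z)(u^2 v + u v^2): the difference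
    quotient is a sum of two transforms that agree at w = z. *)
Lemma CT_der2 (s : R) (phi : R -> C) (z : C) :
  (forall th, continuous phi th) -> Cmod z < s -> Cder (CT s phi 2) z (2 * CT s phi 3 z).
Proof.
  intros Hp Hz.
  set (ph k := fun th => (phi th * Cpow (/ (RtoC s * cis th - z)) k)%C).
  assert (Hph : forall k th, continuous (ph k) th) by (intros; now apply continuous_kernel).
  exists (fun w => CT s (ph 1%nat) 2 w + CT s (ph 2%nat) 1 w)%C. split; [|split].
  - apply continuous_Cplus; now apply continuous_CT.
  - replace (2 * CT s phi 3 z)%C with (CT s phi 3 z + CT s phi 3 z)%C by ring.
    f_equal; apply Cmean_ext; intros th; unfold ph; simpl; ring.
  - generalize (locally_disc z s Hz). apply filter_imp. intros w Hw. unfold CT.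
    rewrite Cmult_comm.
    rewrite <- Cmean_plus by (intros; now apply continuous_kernel).
    assert (Cs : forall th, continuous (fun th => ph 1%nat th * Cpow (/ (RtoC s * cis th - w)) 2 +
       ph 2%nat th * Cpow (/ (RtoC s * cis th - w)) 1)%C th).
    { intros; apply continuous_Cplus; now apply continuous_kernel. }
    rewrite <- Cmean_scal by auto.
    rewrite <- Cmean_plus.
    + apply Cmean_ext. intros th. unfold ph; simpl. field.
      split; now apply circle_minus_neq_0.
    + intros; now apply continuous_kernel.
    + intros; apply continuous_Cmult; [apply continuous_const | auto].
Qed.

Lemma Hol_CT1 (s : R) (phi : R -> C) :
  (forall th, continuous phi th) -> Hol s (CT s phi 1).
Proof.
  intros Hp. apply (Hol_intro s _ (CT s phi 2)); intros z Hz.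
  - now apply CT_der1.
  - now apply continuous_CT.
Qed.

Lemma Hol_CT2 (s : R) (phi : R -> C) :
  (forall th, continuous phi th) -> Hol s (CT s phi 2).
Proof.
  intros Hp. apply (Hol_intro s _ (fun z => 2 * CT s phi 3 z)%C); intros z Hz.
  - now apply CT_der2.
  - apply continuous_Cmult; [apply continuous_const | now apply continuous_CT].
Qed.

Lemma Hol_is_CT (r s : R) (g : C -> C) :
  Hol r g -> 0 < s < r ->
  exists phi, (forall th, continuous phi th) /\
    (forall z, Cmod z < s -> g z = CT s phi 1 z) /\
    (forall z, Cmod z < s -> Cd g z = CT s phi 2 z).
Proof.
  intros Hg Hs. exists (fun th => g (RtoC s * cis th) * (RtoC s * cis th))%C.
  assert (Hp : forall th, continuous (fun th => g (RtoC s * cis th) * (RtoC s * cis th))%C th).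
  { intros th. apply continuous_Cmult; [|apply continuous_circle].
    apply (continuous_comp (fun th => RtoC s * cis th)%C g); [apply continuous_circle|].
    apply (Hol_continuous r); auto. rewrite Cmod_circle; lra. }
  assert (E : forall z, Cmod z < s ->
    g z = CT s (fun th => g (RtoC s * cis th) * (RtoC s * cis th))%C 1 z).
  { intros z Hz. rewrite (Cauchy_formula r s g z Hg) by lra.
    apply Cmean_ext. intros th. simpl. field. now apply circle_minus_neq_0. }
  repeat split; auto.
  intros z Hz. apply Cd_unique.
  apply Cder_ext_loc with (2 := CT_der1 s _ z Hp Hz).
  generalize (locally_disc z s Hz). apply filter_imp. intros w Hw; symmetry; auto.
Qed.

(** Inside each smaller circle the derivative is a transform with k = 2, which is differentiable in
    turn. *)
Lemma Hol_Cd (r : R) (g : C -> C) : Hol r g -> Hol r (Cd g).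
Proof.
  intros Hg. apply Hol_local. intros s Hs.
  destruct (Hol_is_CT r s g Hg Hs) as [phi [Hp [_ E]]].
  exists (CT s phi 2). split; [now apply Hol_CT2 | intros; symmetry; auto].
Qed.

Lemma Hol_divided_difference (r : R) (g : C -> C) (a : C) :
  Hol r g -> Cmod a < r ->
  exists h, Hol r h /\ h a = Cd g a /\ forall z, Cmod z < r -> g z = (g a + (z - a) * h z)%C.
Proof.
  intros Hg Ha. pose proof (Cmod_ge_0 a) as Ha0.
  exists (fun z => if Ceq_dec z a then Cd g a else (g z - g a) / (z - a))%C.
  split; [|split].
  - assert (K : forall s, Cmod a < s < r -> exists f : C -> C, Hol s f /\ forall z, Cmod z < s ->
       f z = (if Ceq_dec z a then Cd g a else (g z - g a) / (z - a))%C).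
    { intros s Hs. destruct (Hol_is_CT r s g Hg ltac:(lra)) as [phi [Hp [E1 E2]]].
      set (phia := fun th => (phi th * Cpow (/ (RtoC s * cis th - a)) 1)%C).
      assert (Hpa : forall th, continuous phia th) by (intros; apply continuous_kernel; auto; apply Hs).
      exists (CT s phia 1). split; [now apply Hol_CT1|].
      intros z Hz. destruct (Ceq_dec z a) as [->|Hn].
      - rewrite E2 by lra. apply Cmean_ext. intros th; unfold phia; simpl; ring.
      - assert (Hza : (z - a)%C <> RtoC 0) by now apply Cminus_eq_contra.
        rewrite !E1 by lra. unfold CT.
        rewrite <- Cmean_minus by (intros; apply continuous_kernel; auto; lra).
        unfold Cdiv. rewrite Cmult_comm, <- Cmean_scal.
        + apply Cmean_ext. intros th. unfold phia; simpl. field.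
          repeat split; auto; apply circle_minus_neq_0; auto; lra.
        + intros th; apply continuous_Cminus; apply continuous_kernel; auto; lra. }
    apply Hol_local. intros s Hs.
    (* The circle of integration must enclose a, so a small s is enlarged past |a| and the result
       restricted afterwards. *)
    destruct (K (Rmax s ((Cmod a + r) / 2))) as [f [Hf Ef]].
    { split.
      - apply Rlt_le_trans with (2 := Rmax_r _ _). lra.
      - apply Rmax_lub_lt; lra. }
    exists f. split.
    + apply (Hol_le _ s) in Hf; auto. apply Rmax_l.
    + intros z Hz. apply Ef. apply Rlt_le_trans with (1 := Hz), Rmax_l.
  - now destruct (Ceq_dec a a).
  - intros z Hz. destruct (Ceq_dec z a) as [->|Hn].
    + ring.
    + field. now apply Cminus_eq_contra.
Qed.

Lemma Hol_factor (r : R) (g : C -> C) (a : C) :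
  Hol r g -> Cmod a < r -> g a = 0 ->
  exists h, Hol r h /\ forall z, Cmod z < r -> g z = ((z - a) * h z)%C.
Proof.
  intros Hg Ha E. destruct (Hol_divided_difference r g a Hg Ha) as [h [Hh [_ H]]].
  exists h; split; auto. intros z Hz. rewrite (H z Hz), E. ring.
Qed.

(* By Cauchy's formula |g(a)| <= C M with C depending on a only; apply this to all powers of g. *)
Lemma maximum_principle (r s M : R) (g : C -> C) (a : C) :
  Hol r g -> Cmod a < s < r -> (forall z, Cmod z = s -> Cmod (g z) <= M) -> Cmod (g a) <= M.
Proof.
  intros Hg Hs HM. pose proof (Cmod_ge_0 a) as Ha.
  set (K := s / (s - Cmod a)).
  assert (HM0 : 0 <= M).
  { apply Rle_trans with (2 := HM (RtoC s * cis 0)%C ltac:(apply Cmod_circle; lra)). apply Cmod_ge_0. }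
  assert (P : forall n, Cmod (g a) ^ n <= M ^ n * K).
  { intros n. rewrite <- Cmod_pow.
    rewrite (Cauchy_formula r s (fun z => Cpow (g z) n) a (Hol_pow r g n Hg) Hs).
    apply Cmod_Cmean_le.
    - intros th. apply continuous_Cmult.
      + apply continuous_Cpow. apply (continuous_comp (fun th => RtoC s * cis th)%C g).
        * apply continuous_circle.
        * apply (Hol_continuous r); auto. rewrite Cmod_circle; lra.
      + apply continuous_Cdiv.
        * apply continuous_circle.
        * apply continuous_Cminus; [apply continuous_circle | apply continuous_const].
        * apply circle_minus_neq_0; lra.
    - intros th _. assert (N : (RtoC s * cis th - a)%C <> RtoC 0) by (apply circle_minus_neq_0; lra).
      rewrite Cmod_mult, Cmod_pow. apply Rmult_le_compat.
      + apply pow_le, Cmod_ge_0.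
      + apply Cmod_ge_0.
      + apply pow_incr. split; [apply Cmod_ge_0|]. apply HM, Cmod_circle; lra.
      + rewrite Cmod_div, Cmod_circle by (auto; lra). unfold K, Rdiv.
        apply Rmult_le_compat_l; [lra|]. apply Rinv_le_contravar; [lra|].
        apply Rle_trans with (2 := Cmod_triangle_rev _ _). rewrite Cmod_circle; lra. }
  destruct (Rle_lt_dec (Cmod (g a)) M) as [|Hlt]; auto. exfalso.
  destruct (Req_dec M 0) as [->|HMn].
  - specialize (P 1%nat). simpl in P. lra.
  - set (x := Cmod (g a) / M).
    assert (Hx : 1 < x).
    { unfold x. apply Rmult_lt_reg_r with M; [lra|]. unfold Rdiv; rewrite Rmult_assoc, Rinv_l; lra. }
    destruct (Pow_x_infinity x ltac:(rewrite Rabs_pos_eq; lra) (K + 1)) as [N HN].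
    specialize (HN N (le_n N)). specialize (P N).
    rewrite Rabs_pos_eq in HN by (apply pow_le; lra).
    assert (E : Cmod (g a) ^ N = x ^ N * M ^ N).
    { rewrite <- Rpow_mult_distr. f_equal. unfold x; field; auto. }
    rewrite E in P. assert (0 < M ^ N) by (apply pow_lt; lra). nra.
Qed.

(** * A weighted Jensen inequality *)

Definition dlog (g : C -> C) (z : C) : C := (Cd g z / g z)%C.

(** This is (log g)''(0), written without choosing a branch of the logarithm. *)
Definition lam (g : C -> C) : C := Cd (dlog g) 0.

Lemma Hol_dlog (r : R) (g : C -> C) :
  Hol r g -> (forall z, Cmod z < r -> g z <> RtoC 0) -> Hol r (dlog g).
Proof. intros Hg H0. apply Hol_mult; [now apply Hol_Cd | now apply Hol_inv]. Qed.

(** log |u| is the real part of any local branch of log u, whose derivative is u' / u. *)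
Lemma is_derive_ln_Cmod (u : R -> C) (t : R) (l : C) :
  is_Cderive u t l -> u t <> RtoC 0 ->
  is_derive (fun x => ln (Cmod (u x))) t (Re (l / u t)).
Proof.
  assert (K : forall (a b : R -> R) (la lb : R), is_derive a t la -> is_derive b t lb ->
    0 < a t * a t + b t * b t ->
    is_derive (fun x => ln (sqrt (a x * a x + b x * b x))) t
      ((la * a t + lb * b t) / (a t * a t + b t * b t))).
  { intros a b la lb Ha Hb S.
    pose proof (sqrt_lt_R0 _ S) as Hs. pose proof (sqrt_sqrt _ (Rlt_le _ _ S)) as Hss.
    auto_derive.
    - repeat split; auto; eexists; eassumption.
    - assert (Ea : Derive (fun x : R => a x) t = la) by now apply is_derive_unique.
      assert (Eb : Derive (fun x : R => b x) t = lb) by now apply is_derive_unique.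
      rewrite Ea, Eb. set (q := sqrt (a t * a t + b t * b t)) in *.
      rewrite <- Hss. field. lra. }
  intros [H1 H2] H0. pose proof (proj1 (Cmod_gt_0 _) H0) as Hp.
  assert (S : 0 < Re (u t) * Re (u t) + Im (u t) * Im (u t)).
  { assert (H : 0 < Cmod (u t) ^ 2) by (apply pow_lt; auto). rewrite Cmod2_alt in H. simpl in H. lra. }
  apply (is_derive_ext (fun x => ln (sqrt (Re (u x) * Re (u x) + Im (u x) * Im (u x))))).
  { intros x. unfold Cmod, Re, Im. do 2 f_equal. simpl; ring. }
  replace (Re (l / u t)) with
    ((Re l * Re (u t) + Im l * Im (u t)) / (Re (u t) * Re (u t) + Im (u t) * Im (u t))).
  - now apply (K (fun x => Re (u x)) (fun x => Im (u x))).
  - destruct l, (u t); unfold Re, Im in *; simpl in *. field. lra.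
Qed.

(** Equal to 2 sin^2 th. The points R (cos th + I sin th) with th fixed form a 2-sphere of radius R
    |sin th|, so sin^2 th is the density of the angle for the measure of the 3-sphere; the factor 2
    makes the mean 1. *)
Definition weight (th : R) : R := 1 - cos (2 * th).

Lemma weight_pos (th : R) : 0 <= weight th.
Proof. unfold weight. pose proof (COS_bound (2 * th)); lra. Qed.

Lemma continuous_weight (th : R) : continuous weight th.
Proof.
  unfold weight. apply (continuous_minus (V := R_NormedModule)); [apply continuous_const|].
  apply continuous_cos_comp. apply (continuous_scal_r 2 (fun x : R => x)). apply continuous_id.
Qed.

Lemma weight_cis (th : R) :
  (RtoC (weight th) = 1 - (cis th * cis th + Cconj (cis th) * Cconj (cis th)) / 2)%C.
Proof.
  pose proof (sin2_cos2 th) as H. unfold Rsqr in H.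
  unfold weight. rewrite cos_2a. apply injective_projections; simpl; field.
Qed.

Lemma rmean_weight : rmean weight = 1.
Proof.
  unfold rmean. rewrite (is_RInt_unique (V := R_CompleteNormedModule) weight 0 (2 * PI) (2 * PI)).
  - field. pose proof PI_RGT_0; lra.
  - replace (2 * PI) with
      (minus ((2 * PI) - sin (2 * (2 * PI)) / 2) (0 - sin (2 * 0) / 2)) at 2.
    + apply (is_RInt_derive (V := R_CompleteNormedModule) (fun x => x - sin (2 * x) / 2)).
      * intros x _. unfold weight. auto_derive; auto. field.
      * intros; apply continuous_weight.
    + unfold minus, plus, opp; simpl.
      rewrite sin_2a, sin_2PI, Rmult_0_r, sin_0. field.
Qed.

Lemma rmean_weight_const (c : R) : rmean (fun th => weight th * c) = c.
Proof.
  rewrite (rmean_ext _ (fun th => c * weight th)) by (intros; ring).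
  rewrite rmean_scal, rmean_weight by apply continuous_weight. ring.
Qed.

(** Write e for [cis th]. The weight is 1 - (e^2 + conj e^2) / 2, and e L(t e) and e^3 L(t e) have
    mean 0. There remains - conj e L(t e) / 2, and in L(t e) = L(0) + t e L'(0) + t^2 e^2 L2(t e)
    only the linear term survives the mean. *)
Lemma weighted_mean_dlog (r t : R) (L : C -> C) :
  Hol r L -> Rabs t < r ->
  Cmean (fun th => RtoC (weight th) * (cis th * L (RtoC t * cis th)))%C =
  (- (RtoC t / 2) * Cd L 0)%C.
Proof.
  intros HL Ht. pose proof (Rabs_pos t) as Ht0.
  assert (H0r : Cmod 0 < r) by (rewrite Cmod_0; lra).
  destruct (Hol_divided_difference r L 0 HL H0r) as [L1 [HL1 [E0 E1]]].
  destruct (Hol_divided_difference r L1 0 HL1 H0r) as [L2 [HL2 [_ E2]]].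
  (* Chosen with 1 < r1 and |t| r1 <= r, so that z |-> L (t z) is holomorphic beyond the unit
     circle. *)
  set (r1 := 2 * r / (r + Rabs t)).
  assert (Hr1 : 1 < r1).
  { unfold r1. apply Rmult_lt_reg_r with (r + Rabs t); [lra|].
    unfold Rdiv; rewrite Rmult_assoc, Rinv_l; lra. }
  assert (Htr : Rabs t * r1 <= r).
  { unfold r1. replace (Rabs t * (2 * r / (r + Rabs t))) with (r * (2 * Rabs t / (r + Rabs t))) by (field; lra).
    rewrite <- (Rmult_1_r r) at 3. apply Rmult_le_compat_l; [lra|].
    apply Rmult_le_reg_r with (r + Rabs t); [lra|].
    unfold Rdiv; rewrite Rmult_assoc, Rinv_l; lra. }
  (* All terms that are holomorphic in e and vanish at 0; the mean value property disposes of them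
     together. *)
  set (k := fun z => (z * L (RtoC t * z) + (- (1 / 2)) * (z * z * z * L (RtoC t * z)) +
              (- (RtoC t * RtoC t / 2)) * (z * L2 (RtoC t * z)))%C).
  assert (Hk : Hol r1 k).
  { unfold k.
    assert (HLt : Hol r1 (fun z => L (RtoC t * z)%C)) by now apply (Hol_scale r).
    assert (HL2t : Hol r1 (fun z => L2 (RtoC t * z)%C)) by now apply (Hol_scale r).
    apply Hol_plus; [apply Hol_plus|].
    - apply Hol_mult; auto using Hol_id.
    - apply Hol_mult; [apply Hol_const|]. apply Hol_mult; auto. repeat apply Hol_mult; apply Hol_id.
    - apply Hol_mult; [apply Hol_const|]. apply Hol_mult; auto using Hol_id. }
  assert (Ck : forall th, continuous (fun th => k (RtoC 1 * cis th)%C) th).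
  { intros th. apply (continuous_comp (fun th => RtoC 1 * cis th)%C k); [apply continuous_circle|].
    apply (Hol_continuous r1); auto. rewrite Cmod_circle; lra. }
  assert (Cc : forall th, continuous (fun th => Cconj (cis th)) th).
  { intros; apply continuous_Cconj, continuous_cis. }
  rewrite (Cmean_ext _ (fun th => k (RtoC 1 * cis th) +
     ((- (L 0 / 2)) * Cconj (cis th) + (- (RtoC t / 2) * L1 0)))%C).
  - rewrite Cmean_plus, (mean_value r1 1 k Hk), Cmean_plus, Cmean_const, Cmean_scal, Cmean_conj, Cmean_cis, E0; auto.
    + unfold k. replace (Cconj 0) with (RtoC 0) by (apply injective_projections; simpl; ring). ring.
    + intros; apply continuous_cis.
    + intros; apply continuous_Cmult; auto; apply continuous_const.
    + intros; apply continuous_const.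
    + lra.
    + intros; apply continuous_Cplus; [apply continuous_Cmult; auto|]; apply continuous_const.
  - intros th. rewrite weight_cis. unfold k.
    replace (RtoC 1 * cis th)%C with (cis th) by ring.
    assert (Hte : Cmod (RtoC t * cis th) < r) by (rewrite Cmod_mult, Cmod_R, Cmod_cis; lra).
    pose proof (cis_conj th) as Ec.
    set (e := cis th) in *. set (e' := Cconj e) in *.
    assert (EL : (e' * (e' * e * L (RtoC t * e)) =
       e' * L 0 + RtoC t * L1 0 + RtoC t * RtoC t * e * L2 (RtoC t * e))%C).
    { rewrite (Cmult_comm e' e), Ec, (E1 _ Hte), (E2 _ Hte).
      transitivity (e' * L 0 + (e * e') * (RtoC t * L1 0 + (e * e') * (RtoC t * RtoC t * e * L2 (RtoC t * e)) +
          (1 - e * e') * (RtoC t * RtoC t * e * L2 (RtoC t * e))))%C; [ring|].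
      rewrite Ec. ring. }
    transitivity (e * L (RtoC t * e) + - (1 / 2) * (e * e * e * L (RtoC t * e))
       + - (1 / 2) * (e' * (e' * e * L (RtoC t * e))))%C; [field|].
    rewrite EL. field.
Qed.

Lemma continuous_ln_Cmod {U : UniformSpace} (f : U -> C) (x : U) :
  continuous f x -> f x <> RtoC 0 -> continuous (fun y => ln (Cmod (f y))) x.
Proof.
  intros Hf H0. apply (continuous_comp (fun y => Cmod (f y)) ln).
  - now apply continuous_Cmod.
  - apply continuity_pt_filterlim. apply derivable_continuous_pt.
    exists (/ Cmod (f x)). apply derivable_pt_lim_ln. now apply Cmod_gt_0.
Qed.

(* The mean of (1 - cos 2 th) log |g (t e^(i th))| is a quadratic polynomial in t. *)
Lemma weighted_Jensen (r s M : R) (g : C -> C) :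
  Hol r g -> (forall z, Cmod z < r -> g z <> RtoC 0) ->
  (forall z, Cmod z < r -> Cmod (g z) <= M) -> 0 < s < r ->
  ln (Cmod (g 0)) - s ^ 2 / 4 * Re (lam g) <= ln M.
Proof.
  intros Hg H0 HM Hs.
  pose proof (Hol_dlog r g Hg H0) as HL.
  set (Phi := fun t th => weight th * ln (Cmod (g (RtoC t * cis th)%C))).
  set (Psi := fun t th => weight th * Re (cis th * dlog g (RtoC t * cis th))).
  assert (Hin : forall t th, - r < t < r -> Cmod (RtoC t * cis th) < r).
  { intros t th Ht. rewrite Cmod_mult, Cmod_R, Cmod_cis, Rmult_1_r. now apply Rabs_def1. }
  assert (C2 : forall t th, continuous (fun p : R * R => (RtoC (fst p) * cis (snd p))%C) (t, th)).
  { intros t th. apply continuous_Cmult.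
    - apply continuous_RtoC, continuous_fst.
    - apply (continuous_comp snd cis); [apply continuous_snd | apply continuous_cis]. }
  assert (CPhi : forall t th, - r < t < r -> continuous (Phi t) th).
  { intros t th Ht. apply (continuous_mult (K := R_AbsRing)); [apply continuous_weight|].
    apply (continuous_ln_Cmod (fun th => g (RtoC t * cis th)%C)); auto.
    apply (continuous_comp (fun th => RtoC t * cis th)%C g); [apply continuous_circle|].
    apply (Hol_continuous r); auto. }
  assert (D : forall t, - r < t < r -> is_derive (fun x => rmean (Phi x)) t (- (t / 2) * Re (lam g))).
  { intros t Ht.
    replace (- (t / 2) * Re (lam g)) with (rmean (Psi t)).
    - apply (rmean_param Phi Psi (- r) r); auto; intros x th Hx.
      + unfold Phi, Psi. apply (is_derive_scal (fun x => ln (Cmod (g (RtoC x * cis th)%C)))).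
        replace (cis th * dlog g (RtoC x * cis th))%C
          with (Cd g (RtoC x * cis th) * cis th / g (RtoC x * cis th))%C
          by (unfold dlog; field; auto).
        apply (is_derive_ln_Cmod (fun x => g (RtoC x * cis th)%C)); auto.
        apply (Cder_curve g (fun x => RtoC x * cis th)%C); [|apply Hg; auto].
        destruct (is_Cderive_affine 0 (cis th) x) as [A1 A2]. split.
        * apply is_derive_ext with (2 := A1). intros; f_equal; ring.
        * apply is_derive_ext with (2 := A2). intros; f_equal; ring.
      + unfold Psi. apply (continuous_mult (K := R_AbsRing)).
        * apply (continuous_comp snd weight); [apply continuous_snd | apply continuous_weight].
        * apply (continuous_Re (fun p : R * R => cis (snd p) * dlog g (RtoC (fst p) * cis (snd p)))%C).
          apply continuous_Cmult.
          -- apply (continuous_comp snd cis); [apply continuous_snd | apply continuous_cis].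
          -- apply (continuous_comp (fun p : R * R => (RtoC (fst p) * cis (snd p))%C) (dlog g)); auto.
             apply (Hol_continuous r); auto.
    - assert (Ha : Rabs t < r) by now apply Rabs_def1.
      pose proof (weighted_mean_dlog r t (dlog g) HL Ha) as E.
      apply (f_equal Re) in E. rewrite Re_Cmean in E.
      rewrite (rmean_ext _ (Psi t)) in E.
      + rewrite E. unfold lam. destruct (Cd (dlog g) 0). unfold Re; simpl. field.
      + intros th. unfold Psi. now rewrite re_scal_l. }
  assert (E : rmean (Phi 0) = rmean (Phi s) + s ^ 2 / 4 * Re (lam g)).
  { replace (rmean (Phi 0)) with (rmean (Phi 0) + 0 ^ 2 / 4 * Re (lam g)) by (simpl; field).
    apply (eq_is_derive (V := R_NormedModule) (fun t => rmean (Phi t) + t ^ 2 / 4 * Re (lam g)) 0 s); [|lra].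
    intros t Ht. replace (@zero R_NormedModule) with (- (t / 2) * Re (lam g) + t / 2 * Re (lam g))
      by (unfold zero; simpl; ring).
    apply (is_derive_plus (V := R_NormedModule) (fun t => rmean (Phi t))).
    - apply D; lra.
    - generalize (Re (lam g)); intros c. auto_derive; auto. field. }
  assert (E0 : rmean (Phi 0) = ln (Cmod (g 0))).
  { unfold Phi. rewrite <- (rmean_weight_const (ln (Cmod (g 0)))). apply rmean_ext.
    intros th. do 4 f_equal. ring. }
  assert (E1 : rmean (Phi s) <= ln M).
  { rewrite <- (rmean_weight_const (ln M)). apply rmean_le.
    - intros; apply CPhi; lra.
    - intros; apply (continuous_mult (K := R_AbsRing)); [apply continuous_weight | apply continuous_const].
    - intros th _. apply Rmult_le_compat_l; [apply weight_pos|].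
      assert (Hz : Cmod (RtoC s * cis th) < r) by (apply Hin; lra).
      apply ln_le; auto. now apply Cmod_gt_0, H0. }
  lra.
Qed.

(** * The second logarithmic derivative of products and affine factors *)

Lemma dlog_der (r : R) (f : C -> C) :
  0 < r -> Hol r f -> f 0 <> RtoC 0 -> Cder (dlog f) 0 (lam f).
Proof.
  intros Hr Hf H0. assert (Hr0 : Cmod 0 < r) by now rewrite Cmod_0.
  pose proof (Cder_mult (Cd f) (fun z => / f z)%C 0 _ _
    (proj1 (Hol_Cd r f Hf 0 Hr0)) (Cder_inv f 0 _ (proj1 (Hf 0 Hr0)) H0)) as D.
  unfold lam, dlog, Cdiv. now rewrite (Cd_unique _ _ _ D).
Qed.

Lemma lam_mult (r : R) (f g : C -> C) :
  0 < r -> Hol r f -> Hol r g -> f 0 <> RtoC 0 -> g 0 <> RtoC 0 ->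
  lam (fun z => f z * g z)%C = (lam f + lam g)%C.
Proof.
  intros Hr Hf Hg Hf0 Hg0. assert (Hr0 : Cmod 0 < r) by now rewrite Cmod_0.
  apply Cd_unique. apply Cder_ext_loc with (fun z => dlog f z + dlog g z)%C.
  - generalize (filter_and _ _ (locally_disc 0 r Hr0)
      (filter_and _ _ (locally_neq_0 f (RtoC 0) (Hol_continuous r f 0 Hf Hr0) Hf0)
                      (locally_neq_0 g (RtoC 0) (Hol_continuous r g 0 Hg Hr0) Hg0))).
    apply filter_imp. intros z [Hz [Nf Ng]]. unfold dlog.
    rewrite (Cd_unique _ _ _ (Cder_mult f g z _ _ (proj1 (Hf z Hz)) (proj1 (Hg z Hz)))).
    cfield; auto.
  - apply Cder_plus; now apply (dlog_der r).
Qed.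

Lemma Cder_affine (a b z : C) : Cder (fun w => a + b * w)%C z b.
Proof.
  pose proof (Cder_plus _ _ z _ _ (Cder_const a z)
    (Cder_mult _ _ z _ _ (Cder_const b z) (Cder_id z))) as D.
  cbv beta in D. replace (0 + (0 * z + b * 1))%C with b in D by ring. exact D.
Qed.

Lemma lam_affine (a b : C) :
  a <> RtoC 0 -> lam (fun z => a + b * z)%C = (- (b * b) / (a * a))%C.
Proof.
  intros Ha. apply Cd_unique.
  apply Cder_ext_loc with (fun z => b * / (a + b * z))%C.
  - apply filter_forall. intros z. unfold dlog. now rewrite (Cd_unique _ _ _ (Cder_affine a b z)).
  - pose proof (Cder_mult _ _ 0 _ _ (Cder_const b 0)
      (Cder_inv (fun w => a + b * w)%C 0 _ (Cder_affine a b 0) ltac:(cbv beta; replace (a + b * 0)%C with a by ring; auto))) as D.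
    cbv beta in D. replace (a + b * 0)%C with a in D by ring.
    replace (- (b * b) / (a * a))%C with (0 * / a + b * (- b / (a * a)))%C; auto.
    field; auto.
Qed.

Lemma lam_ext (r : R) (f g : C -> C) :
  0 < r -> (forall z, Cmod z < r -> f z = g z) -> lam f = lam g.
Proof.
  intros Hr H. apply Cd_ext_loc.
  assert (Hr0 : Cmod 0 < r) by now rewrite Cmod_0.
  generalize (locally_disc 0 r Hr0). apply filter_imp. intros z Hz. unfold dlog. rewrite H by auto.
  f_equal. apply Cd_ext_loc. generalize (locally_disc z r Hz). apply filter_imp; auto.
Qed.

(** * Removal of zeros by Blaschke factors *)

(** Away from w one divides; at w itself h(w) is recovered as the derivative of (z - w) h(z). *)
Lemma Hol_cancel (r : R) (f g : C -> C) (w : C) :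
  Hol r f -> Hol r g ->
  (forall z, Cmod z < r -> ((z - w) * f z = (z - w) * g z)%C) ->
  forall z, Cmod z < r -> f z = g z.
Proof.
  intros Hf Hg E z Hz.
  assert (D : forall h, Hol r h -> Cmod w < r -> Cd (fun z => (z - w) * h z)%C w = h w).
  { intros h Hh Hw. apply Cd_unique.
    pose proof (Cder_mult _ h w _ _ (Cder_affine (- w) 1 w) (proj1 (Hh w Hw))) as D.
    cbv beta in D. replace (1 * h w + (- w + 1 * w) * Cd h w)%C with (h w) in D by ring.
    apply Cder_ext_loc with (2 := D). apply filter_forall. intros x; cring. }
  destruct (Ceq_dec z w) as [->|Hn].
  - rewrite <- (D f), <- (D g) by auto. apply Cd_ext_loc.
    generalize (locally_disc w r Hz). apply filter_imp; auto.
  - assert (Hzw : (z - w)%C <> RtoC 0) by now apply Cminus_eq_contra.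
    replace (f z) with ((z - w) * f z / (z - w))%C by (field; auto).
    rewrite E by auto. field; auto.
Qed.

(* H' arises from H by replacing factors z - w, |w| < rho, by rho - conj w z / rho:
   moduli on |z| = rho are unchanged while log |H 0| grows by at least d. *)
Record reduces (r rho : R) (H H' : C -> C) (d : R) : Prop := {
  reduces_Hol : Hol r H';
  reduces_neq : H' 0 <> RtoC 0;
  reduces_circle : forall z, Cmod z = rho -> Cmod (H' z) = Cmod (H z);
  reduces_zeros : forall z, Cmod z < rho -> H' z = 0 -> H z = 0;
  reduces_ln : ln (Cmod (H 0)) + d <= ln (Cmod (H' 0));
  reduces_lam : Re (lam H') <= Re (lam H) }.

Lemma reduces_refl (r rho : R) (H : C -> C) :
  Hol r H -> H 0 <> RtoC 0 -> reduces r rho H H 0.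
Proof. intros; split; auto; lra. Qed.

Lemma reduces_trans (r rho : R) (H H1 H2 : C -> C) (d1 d2 : R) :
  reduces r rho H H1 d1 -> reduces r rho H1 H2 d2 -> reduces r rho H H2 (d1 + d2).
Proof.
  intros [A1 A2 A3 A4 A5 A6] [B1 B2 B3 B4 B5 B6]; split; auto; try lra.
  intros z Hz; now rewrite B3, A3.
Qed.

Lemma reduces_le (r rho : R) (H H' : C -> C) (d d' : R) :
  d' <= d -> reduces r rho H H' d -> reduces r rho H H' d'.
Proof. intros Hd [A1 A2 A3 A4 A5 A6]; split; auto; lra. Qed.

(** Divisibility takes the place of an order of vanishing, matching the definition of the total
    multiplicity; m may be smaller than the order of H at v. *)
Definition divides (r : R) (v : C) (m : nat) (H : C -> C) : Prop :=
  exists K, Hol r K /\ forall z, Cmod z < r -> H z = (Cpow (z - v) m * K z)%C.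

(** On the circle z conj z = rho^2, so the new factor equals (z / rho) conj (z - w), and z / rho has
    modulus 1. *)
Lemma blaschke_modulus (rho : R) (w z : C) :
  0 < rho -> Cmod z = rho ->
  Cmod (RtoC rho + (- (Cconj w / RtoC rho)) * z) = Cmod (z - w).
Proof.
  intros Hr Hz.
  assert (Hrn : RtoC rho <> RtoC 0) by (intros E; apply RtoC_inj in E; lra).
  assert (E : (RtoC rho + (- (Cconj w / RtoC rho)) * z = z / RtoC rho * Cconj (z - w))%C).
  { rewrite Cminus_conj.
    assert (Ez : (z * Cconj z = RtoC rho * RtoC rho)%C).
    { rewrite <- Cmod2_conj, Hz, <- RtoC_mult. f_equal; ring. }
    transitivity ((z * Cconj z) / RtoC rho - z / RtoC rho * Cconj w)%C; [rewrite Ez|]; field; auto. }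
  rewrite E, Cmod_mult, Cmod_div, Cmod_conj, Cmod_R, Rabs_pos_eq, Hz by (auto; lra).
  field; lra.
Qed.

(** A zero of this factor would satisfy conj w z = rho^2, impossible when both moduli are below
    rho. *)
Lemma blaschke_neq_0 (rho : R) (w z : C) :
  Cmod w < rho -> Cmod z < rho -> (RtoC rho + (- (Cconj w / RtoC rho)) * z)%C <> RtoC 0.
Proof.
  intros Hw Hz E. pose proof (Cmod_ge_0 w). pose proof (Cmod_ge_0 z).
  assert (Hrn : RtoC rho <> RtoC 0) by (intros E0; apply RtoC_inj in E0; lra).
  assert (E1 : (Cconj w * z = RtoC rho * RtoC rho)%C).
  { replace (Cconj w * z)%C with (RtoC rho * RtoC rho - RtoC rho * (RtoC rho + (- (Cconj w / RtoC rho)) * z))%C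
      by (field; auto).
    rewrite E; ring. }
  apply (f_equal Cmod) in E1. rewrite !Cmod_mult, Cmod_conj, Cmod_R, Rabs_pos_eq in E1 by lra.
  nra.
Qed.

(** The two sides are Re [lam] of the new factor and of z - w, that is Re of - (conj w)^2 / rho^4
    and of - (conj w)^2 / |w|^4. As Re w^2 <= 0 both are nonnegative, and |w| < rho orders them. The
    opening angle of the cone is exactly this sign condition. *)
Lemma blaschke_lam (rho : R) (w : C) :
  w <> RtoC 0 -> Cmod w < rho -> Re (w * w) <= 0 ->
  Re (- (- (Cconj w / RtoC rho) * - (Cconj w / RtoC rho)) / (RtoC rho * RtoC rho)) <=
  Re (- (1 * 1) / (- w * - w)).
Proof.
  intros Hw0 Hw Hc.
  pose proof (proj1 (Cmod_gt_0 w) Hw0) as Hp.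
  assert (Hrn : RtoC rho <> RtoC 0) by (intros E0; apply RtoC_inj in E0; lra).
  set (n := Cmod w ^ 2). assert (Hn : 0 < n) by (apply pow_lt; auto).
  assert (Hnr : n < rho ^ 2) by (unfold n; nra).
  assert (Hcn : RtoC n <> RtoC 0) by (intros E0; apply RtoC_inj in E0; lra).
  assert (Ew : (w * Cconj w = RtoC n)%C) by (symmetry; apply Cmod2_conj).
  assert (Hwc : Cconj w <> RtoC 0) by (intros E0; rewrite E0 in Ew; apply Hcn; rewrite <- Ew; ring).
  replace (- (- (Cconj w / RtoC rho) * - (Cconj w / RtoC rho)) / (RtoC rho * RtoC rho))%C
    with (RtoC (- / (rho ^ 2 * rho ^ 2)) * (Cconj w * Cconj w))%C.
  2: { replace (- / (rho ^ 2 * rho ^ 2)) with (- / (rho * rho * (rho * rho))) by (f_equal; f_equal; ring).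
       rewrite RtoC_opp, RtoC_inv, !RtoC_mult by nra. field; auto. }
  replace (- (1 * 1) / (- w * - w))%C with (RtoC (- / (n * n)) * (Cconj w * Cconj w))%C.
  2: { rewrite RtoC_opp, RtoC_inv, RtoC_mult by nra. rewrite <- Ew. field; auto. }
  rewrite !re_scal_l.
  assert (Hre : Re (Cconj w * Cconj w) <= 0) by (destruct w; unfold Re in *; simpl in *; lra).
  assert (/ (rho ^ 2 * rho ^ 2) <= / (n * n)) by (apply Rinv_le_contravar; nra).
  nra.
Qed.

(** With H = (z - w) h, the new function is B h, where B is the factor replacing z - w. The two
    divisibility clauses let the step be iterated: one factor is spent at w and none elsewhere. *)
Lemma blaschke_step (r rho : R) (H : C -> C) (w : C) :
  Hol r H -> H 0 <> RtoC 0 -> 0 < rho < r -> Cmod w < rho -> H w = 0 -> Re (w * w) <= 0 ->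
  exists H', reduces r rho H H' (ln rho - ln (Cmod w)) /\
    (forall v m, v <> w -> divides r v m H -> divides r v m H') /\
    (forall m, divides r w (S m) H -> divides r w m H').
Proof.
  intros HH H0 Hrho Hw Ew Hc.
  assert (Hwr : Cmod w < r) by lra.
  destruct (Hol_factor r H w HH Hwr Ew) as [h [Hh Eh]].
  set (B := fun z => (RtoC rho + (- (Cconj w / RtoC rho)) * z)%C).
  assert (HB : Hol r B) by apply Hol_affine.
  assert (H0r : Cmod 0 < r) by (rewrite Cmod_0; lra).
  assert (Hrn : RtoC rho <> RtoC 0) by (intros E0; apply RtoC_inj in E0; lra).
  assert (EH0 : H 0 = ((- w) * h 0)%C) by (rewrite (Eh 0 H0r); ring).
  assert (Hh0 : h 0 <> RtoC 0) by (intros E; apply H0; rewrite EH0, E; ring).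
  assert (Hw0 : w <> RtoC 0) by (intros E; apply H0; rewrite EH0, E; ring).
  assert (B0 : B 0 = RtoC rho) by (unfold B; ring).
  exists (fun z => B z * h z)%C. split; [split|split].
  - now apply Hol_mult.
  - rewrite B0. now apply Cmult_neq_0.
  - intros z Hz. rewrite (Eh z) by lra. rewrite !Cmod_mult. f_equal.
    unfold B. apply blaschke_modulus; lra.
  - intros z Hz E. rewrite (Eh z) by lra.
    destruct (Ceq_dec (h z) 0) as [->|N]; [ring|].
    exfalso. revert E. apply Cmult_neq_0; auto. now apply blaschke_neq_0.
  - rewrite B0, EH0, !Cmod_mult, Cmod_opp, Cmod_R, Rabs_pos_eq by lra.
    rewrite !ln_mult; try (now apply Cmod_gt_0); try lra.
  - rewrite (lam_mult r B h); auto; try lra; [|now rewrite B0].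
    rewrite (lam_ext r H (fun z => (- w + 1 * z) * h z)%C); [|lra|intros z Hz; rewrite (Eh z Hz); ring].
    assert (Hw00 : (- w)%C <> RtoC 0).
    { intros E; apply Hw0. replace w with (- - w)%C by ring. rewrite E; ring. }
    rewrite (lam_mult r (fun z => - w + 1 * z)%C h); auto; try lra.
    + unfold B. rewrite !lam_affine by auto.
      pose proof (blaschke_lam rho w Hw0 Hw Hc) as K. unfold Re in *; simpl in *. lra.
    + apply Hol_affine.
    + replace (- w + 1 * 0)%C with (- w)%C by ring. auto.
  (* Since v differs from w, the zero of H at w falls on the cofactor K, from which z - w is split
     off and cancelled. *)
  - intros v m Hv [K [HK EK]].
    assert (EKw : K w = 0).
    { destruct (Ceq_dec (K w) 0) as [|N]; auto. exfalso.
      rewrite (EK w Hwr) in Ew. revert Ew. apply Cmult_neq_0; auto.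
      apply Cpow_nz. apply Cminus_eq_contra; auto. }
    destruct (Hol_factor r K w HK Hwr EKw) as [k [Hk Ek]].
    exists (fun z => B z * k z)%C. split; [now apply Hol_mult|].
    assert (Ehk : forall z, Cmod z < r -> h z = (Cpow (z - v) m * k z)%C).
    { apply (Hol_cancel r h _ w); auto.
      - apply Hol_mult; auto. apply Hol_pow.
        apply (Hol_ext r (fun z => - v + 1 * z)%C); [intros; ring | apply Hol_affine].
      - intros z Hz. rewrite <- (Eh z Hz), (EK z Hz), (Ek z Hz). ring. }
    intros z Hz. rewrite (Ehk z Hz). ring.
  - intros m [K [HK EK]]. exists (fun z => B z * K z)%C. split; [now apply Hol_mult|].
    assert (Ehk : forall z, Cmod z < r -> h z = (Cpow (z - w) m * K z)%C).
    { apply (Hol_cancel r h _ w); auto.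
      - apply Hol_mult; auto. apply Hol_pow.
        apply (Hol_ext r (fun z => - w + 1 * z)%C); [intros; ring | apply Hol_affine].
      - intros z Hz. rewrite <- (Eh z Hz), (EK z Hz). simpl. ring. }
    intros z Hz. rewrite (Ehk z Hz). ring.
Qed.

(** Re z^2 = alpha^2 - beta^2, so the condition says |alpha| <= |beta|: the cone as seen in one
    slice, both half planes included. *)
Definition zeros_in_cone (rho : R) (H : C -> C) : Prop :=
  forall z, Cmod z < rho -> H z = 0 -> Re (z * z) <= 0.

Lemma reduces_cone (r rho d : R) (H H' : C -> C) :
  reduces r rho H H' d -> zeros_in_cone rho H -> zeros_in_cone rho H'.
Proof. intros Hr Hc z Hz E. apply Hc; auto. now apply Hr. Qed.

(** Each of the m factors gains log rho - log |v|, which is at least log rho - log s. Divisibility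
    at other points is carried along for the sake of the next zeros in a list. *)
Lemma remove_zero (r rho s : R) (v : C) (m : nat) :
  0 < s < rho -> rho < r -> Cmod v < s -> forall H : C -> C,
  Hol r H -> H 0 <> RtoC 0 -> zeros_in_cone rho H -> divides r v m H ->
  exists H', reduces r rho H H' (INR m * (ln rho - ln s)) /\
    (forall u k, u <> v -> divides r u k H -> divides r u k H').
Proof.
  intros Hs Hrho Hv. induction m as [|m IH]; intros H HH H0 Hc Hd.
  - exists H. split; auto. simpl INR. rewrite Rmult_0_l. now apply reduces_refl.
  - assert (Ev : H v = 0).
    { destruct Hd as [K [_ E]]. rewrite (E v) by lra. simpl. ring. }
    destruct (blaschke_step r rho H v) as [H1 [R1 [D1 D2]]]; auto; try lra.
    { apply Hc; auto; lra. }
    assert (Hv0 : v <> RtoC 0) by (intros E; apply H0; rewrite E in Ev; exact Ev).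
    apply Cmod_gt_0 in Hv0.
    destruct (IH H1) as [H2 [R2 D3]].
    + apply R1.
    + apply R1.
    + now apply (reduces_cone _ _ _ _ _ R1).
    + now apply D2.
    + exists H2. split; auto.
      apply reduces_le with ((ln rho - ln (Cmod v)) + INR m * (ln rho - ln s)).
      * rewrite S_INR. assert (ln (Cmod v) <= ln s) by (apply ln_le; lra). lra.
      * now apply (reduces_trans _ _ _ H1).
Qed.

Lemma remove_zeros (r rho s : R) (l : list (C * nat)) :
  0 < s < rho -> rho < r -> NoDup (map fst l) -> forall H : C -> C,
  Hol r H -> H 0 <> RtoC 0 -> zeros_in_cone rho H ->
  (forall v m, In (v, m) l -> Cmod v < s /\ divides r v m H) ->
  exists H', reduces r rho H H' (INR (list_sum (map snd l)) * (ln rho - ln s)).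
Proof.
  intros Hs Hrho. induction l as [|[v m] l IH]; intros Hnd H HH H0 Hc Hl.
  - exists H. simpl. rewrite Rmult_0_l. now apply reduces_refl.
  - simpl in Hnd. apply NoDup_cons_iff in Hnd. destruct Hnd as [Hn Hnd].
    destruct (Hl v m (or_introl eq_refl)) as [Hv Hd].
    destruct (remove_zero r rho s v m Hs Hrho Hv H HH H0 Hc Hd) as [H1 [R1 D1]].
    destruct (IH Hnd H1) as [H2 R2].
    + apply R1.
    + apply R1.
    + now apply (reduces_cone _ _ _ _ _ R1).
    + intros u k Hu. destruct (Hl u k (or_intror Hu)) as [Hus Hud]. split; auto.
      apply D1; auto. intros ->. apply Hn. apply (in_map fst) in Hu. exact Hu.
    + exists H2. simpl list_sum. rewrite plus_INR, Rmult_plus_distr_r.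
      now apply (reduces_trans _ _ _ H1).
Qed.

(* Each removal increases log |H 0| <= log M by a fixed amount, so the process stops. *)
Lemma remove_all_zeros (r rho p M : R) (N : nat) :
  0 < p < rho -> rho < r -> forall H : C -> C,
  Hol r H -> H 0 <> RtoC 0 -> zeros_in_cone rho H ->
  (forall z, Cmod z = rho -> Cmod (H z) <= M) ->
  ln M - ln (Cmod (H 0)) < INR N * (ln rho - ln p) ->
  exists H', reduces r rho H H' 0 /\ forall z, Cmod z < p -> H' z <> RtoC 0.
Proof.
  intros Hp Hrho. induction N as [|N IH]; intros H HH H0 Hc HM HN.
  (* With no step left the hypothesis says log M < log |H 0|, against the maximum principle. *)
  - exfalso. simpl in HN. rewrite Rmult_0_l in HN.
    assert (Cmod (H 0) <= M).
    { apply (maximum_principle r rho); auto. rewrite Cmod_0; lra. }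
    apply Cmod_gt_0 in H0. assert (ln (Cmod (H 0)) <= ln M) by (apply ln_le; auto). lra.
  - destruct (Classical_Prop.classic (exists z, Cmod z < p /\ H z = 0)) as [[w [Hw Ew]]|Hn].
    + destruct (blaschke_step r rho H w) as [H1 [R1 _]]; auto; try lra.
      { apply Hc; auto; lra. }
      assert (Hw0 : w <> RtoC 0) by (intros E; apply H0; rewrite E in Ew; exact Ew).
      apply Cmod_gt_0 in Hw0.
      assert (Hl : ln (Cmod w) <= ln p) by (apply ln_le; lra).
      destruct (IH H1) as [H2 [R2 Z2]].
      * apply R1.
      * apply R1.
      * now apply (reduces_cone _ _ _ _ _ R1).
      * intros z Hz. rewrite (reduces_circle _ _ _ _ _ R1) by auto. auto.
      * rewrite S_INR in HN. pose proof (reduces_ln _ _ _ _ _ R1). lra.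
      * exists H2. split; auto. apply reduces_le with ((ln rho - ln (Cmod w)) + 0).
        -- assert (ln p < ln rho) by (apply ln_increasing; lra). lra.
        -- now apply (reduces_trans _ _ _ H1).
    + exists H. split; [now apply reduces_refl|].
      intros z Hz E. apply Hn. now exists z.
Qed.

(** * The counting bound for a holomorphic function on a disc *)

(** The passage to the limit s -> rho. For B >= 0 any single s suffices, since the left side
    decreases in s. *)
Lemma le_limit_square (A B K rho : R) :
  0 < rho -> (forall s, 0 < s < rho -> A - s ^ 2 * B <= K) -> A - rho ^ 2 * B <= K.
Proof.
  intros Hr H. destruct (Rle_lt_dec (A - rho ^ 2 * B) K) as [|Hlt]; auto. exfalso.
  destruct (Rle_lt_dec 0 B) as [HB|HB].
  - specialize (H (rho / 2) ltac:(lra)). nra.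
  - set (d := A - rho ^ 2 * B - K). assert (Hd : 0 < d) by (unfold d; lra).
    (* At s = rho - e the left side falls short of its value at rho by at most 2 e rho (- B) <= d /
       2, which is less than the supposed excess d. *)
    set (e := Rmin (rho / 2) (d / (4 * rho * - B))).
    assert (Hq : 0 < d / (4 * rho * - B)).
    { apply Rdiv_lt_0_compat; auto. apply Rmult_lt_0_compat; lra. }
    assert (He : 0 < e) by (apply Rmin_pos; lra).
    assert (He1 : e <= rho / 2) by apply Rmin_l.
    assert (He2 : e * (4 * rho * - B) <= d).
    { apply Rle_trans with (d / (4 * rho * - B) * (4 * rho * - B)).
      - apply Rmult_le_compat_r; [nra|]. apply Rmin_r.
      - right; field. split; lra. }
    specialize (H (rho - e) ltac:(lra)). unfold d in *.
    assert (0 < e * rho * - B) by (repeat apply Rmult_lt_0_compat; lra).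
    assert (0 <= e * e * - B) by (repeat apply Rmult_le_pos; lra).
    assert ((rho - e) ^ 2 * B = rho ^ 2 * B + 2 * (e * rho * - B) - e * e * - B) by ring. nra.
Qed.

(** Two rounds of removal: the factors listed in [l] go with their gain recorded, then the remaining
    zeros of a smaller disc go with the gain dropped, and the weighted mean applies to what is left.
    Throughout, the modulus on |z| = rho is that of H. *)
Lemma zero_count_bound (r rho s M : R) (l : list (C * nat)) (H : C -> C) :
  0 < s < rho -> rho < r -> NoDup (map fst l) ->
  Hol r H -> H 0 <> RtoC 0 -> zeros_in_cone rho H ->
  (forall v m, In (v, m) l -> Cmod v < s /\ divides r v m H) ->
  (forall z, Cmod z = rho -> Cmod (H z) <= M) ->
  INR (list_sum (map snd l)) * (ln rho - ln s) <=
  ln M - ln (Cmod (H 0)) + rho ^ 2 / 4 * Re (lam H).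
Proof.
  intros Hs Hrho Hnd HH H0 Hc Hl HM.
  destruct (remove_zeros r rho s l Hs Hrho Hnd H HH H0 Hc Hl) as [H1 R1].
  set (S := INR (list_sum (map snd l)) * (ln rho - ln s)) in *.
  enough (ln (Cmod (H 0)) + S - rho ^ 2 * (Re (lam H) / 4) <= ln M) by lra.
  apply le_limit_square; [lra|]. intros t Ht.
  (* Zeros on |z| = rho stay in place, so zero freeness is asked only on |z| < p; the mean is taken
     at t < p < rho. *)
  set (p := (t + rho) / 2).
  assert (HM1 : forall z, Cmod z = rho -> Cmod (H1 z) <= M).
  { intros z Hz. rewrite (reduces_circle _ _ _ _ _ R1) by auto. auto. }
  set (c := ln rho - ln p).
  assert (Hcp : 0 < c).
  { unfold c. assert (ln p < ln rho) by (apply ln_increasing; unfold p; lra). lra. }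
  destruct (INR_unbounded ((ln M - ln (Cmod (H1 0))) / c)) as [N HN].
  destruct (remove_all_zeros r rho p M N) with (H := H1) as [H2 [R2 Z2]].
  - unfold p; lra.
  - auto.
  - apply R1.
  - apply R1.
  - now apply (reduces_cone _ _ _ _ _ R1).
  - auto.
  - apply (Rmult_gt_compat_r c) in HN; auto. unfold Rdiv in HN.
    rewrite Rmult_assoc, Rinv_l, Rmult_1_r in HN by lra. exact HN.
  - pose proof (reduces_trans _ _ _ _ _ _ _ R1 R2) as R3.
    assert (HM2 : forall z, Cmod z = rho -> Cmod (H2 z) <= M).
    { intros z Hz. rewrite (reduces_circle _ _ _ _ _ R3) by auto. auto. }
    pose proof (weighted_Jensen p t M H2
      (Hol_le r p H2 ltac:(unfold p; lra) (reduces_Hol _ _ _ _ _ R3)) Z2) as J.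
    assert (J' := J ltac:(intros z Hz; apply (maximum_principle r rho M H2 z);
       [apply R3 | unfold p in Hz; lra | auto]) ltac:(unfold p; lra)).
    pose proof (reduces_ln _ _ _ _ _ R3). pose proof (reduces_lam _ _ _ _ _ R3). nra.
Qed.

(** * From the closed disc to a larger open disc *)

(** A Lebesgue number argument on the square of half side rho. The gauge at a point of D is half the
    size of a square inside D; at a point outside D it keeps its neighbourhood off the closed disc.
    Compactness bounds the useful gauges below by some d, and a point at distance less than d from
    the disc then lies in a doubled square inside D. *)
Lemma open_contains_larger_disc (D : C -> Prop) (rho : R) :
  0 < rho -> open D -> (forall z, Cmod z <= rho -> D z) ->
  exists r, rho < r /\ forall z, Cmod z < r -> D z.
Proof.
  intros Hrho HD Hin.
  assert (Hdelta : forall u v : R, exists d : posreal,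
    (D (u, v) /\ forall w, Rabs (fst w - u) < 2 * d -> Rabs (snd w - v) < 2 * d -> D w) \/
    (forall x y, Rabs (x - u) < d -> Rabs (y - v) < d -> rho < Cmod (x, y))).
  { intros u v. destruct (classic (D (u, v))) as [Hd|Hd].
    - destruct (HD _ Hd) as [e He]. assert (He2 : 0 < e / 2) by (pose proof (cond_pos e); lra).
      exists (mkposreal _ He2). left. split; auto. intros [a b] H1 H2. apply He. simpl in H1, H2.
      split; unfold ball; simpl; unfold AbsRing_ball, abs, minus, plus, opp; simpl; unfold Rminus in H1, H2; lra.
    - assert (Hr : rho < Cmod (u, v)) by (apply Rnot_le_lt; intros H; apply Hd; auto).
      assert (He2 : 0 < (Cmod (u, v) - rho) / 2) by lra.
      exists (mkposreal _ He2). right. intros x y H1 H2. simpl in H1, H2.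
      assert (K : Cmod ((x, y) - (u, v)) <= Rabs (x - u) + Rabs (y - v)).
      { replace ((x, y) - (u, v))%C with (RtoC (x - u) + Ci * RtoC (y - v))%C
          by (apply injective_projections; simpl; ring).
        apply Rle_trans with (1 := Cmod_triangle _ _). rewrite Cmod_mult, Cmod_Ci, !Cmod_R. lra. }
      pose proof (Cmod_triangle ((u, v) - (x, y)) (x, y))%C as T.
      replace ((u, v) - (x, y) + (x, y))%C with ((u, v) : C) in T
        by (apply injective_projections; simpl; ring).
      replace ((u, v) - (x, y))%C with (- ((x, y) - (u, v)))%C in T
        by (apply injective_projections; simpl; ring).
      rewrite Cmod_opp in T. lra. }
  set (delta := fun u v => proj1_sig (constructive_indefinite_description _ (Hdelta u v))).
  destruct (compactness_value_2d (- rho) rho (- rho) rho delta) as [d Hd].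
  exists (rho + d). split; [pose proof (cond_pos d); lra|].
  intros w Hw. destruct (Rle_lt_dec (Cmod w) rho) as [Hle|Hlt]; auto.
  (* The radial projection of w to the circle, at distance |w| - rho < d from w. *)
  set (z := (RtoC (rho / Cmod w) * w)%C).
  assert (Hz : Cmod z = rho).
  { unfold z. rewrite Cmod_mult, Cmod_R, Rabs_pos_eq.
    - field; lra.
    - apply Rdiv_le_0_compat; lra. }
  assert (Hwz : Cmod (w - z) = Cmod w - rho).
  { replace (w - z)%C with (RtoC (1 - rho / Cmod w) * w)%C by (unfold z; rewrite RtoC_minus; ring).
    rewrite Cmod_mult, Cmod_R, Rabs_pos_eq.
    - field; lra.
    - assert (rho / Cmod w <= 1); [|lra].
      apply Rmult_le_reg_r with (Cmod w); [lra|]. unfold Rdiv; rewrite Rmult_assoc, Rinv_l; lra. }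
  clearbody z.
  assert (Hzx : - rho <= fst z <= rho /\ - rho <= snd z <= rho).
  { pose proof (Rmax_Cmod z) as Hm. rewrite Hz in Hm.
    pose proof (Rmax_l (Rabs (fst z)) (Rabs (snd z))). pose proof (Rmax_r (Rabs (fst z)) (Rabs (snd z))).
    split; apply Rabs_le_between; lra. }
  destruct Hzx as [Hz1 Hz2].
  apply NNPP. intros Hn. apply (Hd _ _ Hz1 Hz2). intros [u [v [_ [_ [H1 [H2 H3]]]]]].
  unfold delta in *. destruct (constructive_indefinite_description _ (Hdelta u v)) as [e He]; simpl in H1, H2, H3.
  pose proof (Rmax_Cmod (w - z)%C) as Hm. rewrite Hwz in Hm.
  pose proof (Rmax_l (Rabs (fst (w - z)%C)) (Rabs (snd (w - z)%C))).
  pose proof (Rmax_r (Rabs (fst (w - z)%C)) (Rabs (snd (w - z)%C))).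
  destruct He as [[_ He]|He].
  - apply Hn, He.
    + replace (fst w - u) with (fst (w - z)%C + (fst z - u)) by (simpl; ring).
      apply Rle_lt_trans with (1 := Rabs_triang _ _). lra.
    + replace (snd w - v) with (snd (w - z)%C + (snd z - v)) by (simpl; ring).
      apply Rle_lt_trans with (1 := Rabs_triang _ _). lra.
  - specialize (He (fst z) (snd z) H1 H2). rewrite <- surjective_pairing in He. lra.
Qed.

(** * Slice preserving functions as complex functions *)

Definition qi : quat := (0, (1, (0, 0))).
Definition qj : quat := (0, (0, (1, 0))).
Definition qk : quat := (0, (0, (0, 1))).

Ltac quat_eq :=
  repeat match goal with
  | |- @eq R _ _ => idtac
  | |- _ = _ => apply injective_projections
  end; simpl; unfold plus, minus, opp, scal, mult; simpl; unfold plus, minus, opp, scal, mult; simpl.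

Lemma slice_point_eq (alpha beta a b c d : R) :
  slice_point alpha (a, (b, (c, d))) beta = (alpha + beta * a, (beta * b, (beta * c, beta * d))).
Proof. unfold slice_point, qreal. quat_eq; ring. Qed.

Lemma imag_unit_iff (a b c d : R) :
  imag_unit (a, (b, (c, d))) <-> a = 0 /\ b * b + c * c + d * d = 1.
Proof.
  unfold imag_unit, qreal; simpl. split.
  - intros H. injection H as H1 H2 H3 H4.
    assert (Hb : a * b = 0) by lra. assert (Hc : a * c = 0) by lra. assert (Hd : a * d = 0) by lra.
    assert (a = 0); [|split; nra].
    destruct (Req_dec a 0) as [|Ha]; auto. exfalso.
    apply Rmult_integral in Hb, Hc, Hd.
    destruct Hb as [|Hb]; [easy|]. destruct Hc as [|Hc]; [easy|]. destruct Hd as [|Hd]; [easy|]. subst. nra.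
  - intros [-> H]. repeat f_equal; nra.
Qed.

Lemma imag_unit_qi : imag_unit qi. Proof. apply imag_unit_iff; lra. Qed.
Lemma imag_unit_qj : imag_unit qj. Proof. apply imag_unit_iff; lra. Qed.
Lemma imag_unit_qk : imag_unit qk. Proof. apply imag_unit_iff; lra. Qed.

Lemma qnorm_eq (a b c d : R) : qnorm (a, (b, (c, d))) = sqrt (a * a + (b * b + c * c + d * d)).
Proof. unfold qnorm; simpl. f_equal; ring. Qed.

Lemma qnorm_slice_point (alpha beta : R) (I : quat) :
  imag_unit I -> qnorm (slice_point alpha I beta) = Cmod (alpha, beta).
Proof.
  destruct I as [a [b [c d]]]. intros H. apply imag_unit_iff in H. destruct H as [-> H].
  rewrite slice_point_eq, qnorm_eq. unfold Cmod; simpl. f_equal.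
  transitivity (alpha * alpha + beta * beta * (b * b + c * c + d * d)); [ring|rewrite H; ring].
Qed.

(** The restriction of f to the slice C_i. It is read off f and not off a stem function, so it
    serves at once for every stem function inducing f, in particular for the one that
    [symm_power_divides] supplies. *)
Definition slice_repr (f : quat -> quat) (z : C) : C :=
  let x := f (slice_point (fst z) qi (snd z)) in (fst x, fst (snd x)).

(** Three units suffice: i and - i put F_1 + i F_2 and F_1 - i F_2 into C_i, which kills the j and k
    components of F_1 and F_2; then F_1 + j F_2 in C_j kills their i components. *)
Lemma stem_real (D : C -> Prop) (f : quat -> quat) (F : C -> HC) (z : C) :
  induces D F f -> slice_preserving D f -> D z ->
  F z = (qreal (fst (slice_repr f z)), qreal (snd (slice_repr f z))).
Proof.
  intros HF Hp Hz. destruct z as [x y].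
  assert (K : forall I, imag_unit I -> slice_plane I (plus (fst (F (x, y))) (qmul I (snd (F (x, y)))))).
  { intros I HI. rewrite <- HF by auto. apply Hp; auto.
    - exists x, y, I; auto.
    - exists x, y; auto. }
  pose proof (K qi imag_unit_qi) as K1.
  pose proof (K (0, (-1, (0, 0))) ltac:(apply imag_unit_iff; lra)) as K2.
  pose proof (K qj imag_unit_qj) as K3.
  unfold slice_repr. cbn [fst snd]. rewrite (HF x y qi Hz imag_unit_qi).
  destruct (F (x, y)) as [[a0 [a1 [a2 a3]]] [b0 [b1 [b2 b3]]]].
  destruct K1 as [u1 [v1 K1]]. destruct K2 as [u2 [v2 K2]]. destruct K3 as [u3 [v3 K3]].
  unfold qi, qj in K1, K2, K3. rewrite slice_point_eq in K1, K2, K3.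
  simpl in K1, K2, K3. unfold plus in K1, K2, K3. simpl in K1, K2, K3.
  unfold plus in K1, K2, K3. simpl in K1, K2, K3.
  injection K1 as E1 E2 E3 E4. injection K2 as E5 E6 E7 E8. injection K3 as E9 E10 E11 E12.
  unfold plus in E1, E2, E3, E4, E5, E6, E7, E8, E9, E10, E11, E12.
  simpl in E1, E2, E3, E4, E5, E6, E7, E8, E9, E10, E11, E12.
  unfold qreal, qi. quat_eq; lra.
Qed.

Lemma slice_value (D : C -> Prop) (f : quat -> quat) (F : C -> HC) (x y a b c d : R) :
  induces D F f -> slice_preserving D f -> D (x, y) -> imag_unit (a, (b, (c, d))) ->
  f (slice_point x (a, (b, (c, d))) y) =
    (fst (slice_repr f (x, y)), (snd (slice_repr f (x, y)) * b,
      (snd (slice_repr f (x, y)) * c, snd (slice_repr f (x, y)) * d))).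
Proof.
  intros HF Hp Hz HI. rewrite HF, (stem_real D f F (x, y)) by auto.
  apply imag_unit_iff in HI. destruct HI as [-> _]. unfold qreal. quat_eq; ring.
Qed.

Lemma slice_norm (D : C -> Prop) (f : quat -> quat) (F : C -> HC) (x y : R) (I : quat) :
  induces D F f -> slice_preserving D f -> D (x, y) -> imag_unit I ->
  qnorm (f (slice_point x I y)) = Cmod (slice_repr f (x, y)).
Proof.
  intros HF Hp Hz HI. destruct I as [a [b [c d]]].
  rewrite (slice_value D f F) by auto. apply imag_unit_iff in HI. destruct HI as [_ H].
  rewrite qnorm_eq. destruct (slice_repr f (x, y)) as [u v]. unfold Cmod; simpl. f_equal.
  transitivity (u * u + v * v * (b * b + c * c + d * d)); [ring|rewrite H; ring].
Qed.

Lemma is_derive_fst {U V : NormedModule R_AbsRing} (f : R -> U * V) (t : R) (l : U * V) :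
  is_derive f t l -> is_derive (fun x => fst (f x)) t (fst l).
Proof.
  intros H. apply (filterdiff_comp' f (fun p : U * V => fst p) t (fun y => scal y l) (fun p => fst p)).
  - exact H.
  - apply filterdiff_linear, is_linear_fst.
Qed.

Lemma is_derive_snd {U V : NormedModule R_AbsRing} (f : R -> U * V) (t : R) (l : U * V) :
  is_derive f t l -> is_derive (fun x => snd (f x)) t (snd l).
Proof.
  intros H. apply (filterdiff_comp' f (fun p : U * V => snd p) t (fun y => scal y l) (fun p => snd p)).
  - exact H.
  - apply filterdiff_linear, is_linear_snd.
Qed.

Lemma continuous_fst_comp {T U V : UniformSpace} (f : T -> U * V) (x : T) :
  continuous f x -> continuous (fun y => fst (f y)) x.
Proof. intros H. apply (continuous_comp f fst); [exact H | apply continuous_fst]. Qed.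

Lemma continuous_snd_comp {T U V : UniformSpace} (f : T -> U * V) (x : T) :
  continuous f x -> continuous (fun y => snd (f y)) x.
Proof. intros H. apply (continuous_comp f snd); [exact H | apply continuous_snd]. Qed.

(* The part of p + iota q spanned by 1 and iota. *)
Definition HCscalar (u : HC) : C := (fst (fst u), fst (snd u)).

(** The scalar part of the stem equation is the Cauchy-Riemann system, and a continuous partial
    derivative in alpha together with one in beta at the point gives total differentiability. F may
    have nonreal components here, as the cofactor G of a divisibility may. *)
Lemma Hol_stem (D : C -> Prop) (F : C -> HC) (r : R) :
  holomorphic_stem D F -> (forall z, Cmod z < r -> D z) -> Hol r (fun z => HCscalar (F z)).
Proof.
  intros [Fa [Fb H]] HD.
  apply (Hol_intro r _ (fun z => HCscalar (Fa z))).
  - intros [x y] Hz.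
    assert (L : locally (x, y) (fun w : C => D w)).
    { generalize (locally_disc (x, y) r Hz). apply filter_imp. auto. }
    destruct (H x y (HD _ Hz)) as [H1 [H2 [H3 [H4 H5]]]].
    assert (E : Re (HCscalar (Fa (x, y))) = Im (HCscalar (Fb (x, y))) /\
                Im (HCscalar (Fa (x, y))) = - Re (HCscalar (Fb (x, y)))).
    { destruct (Fa (x, y)) as [[a0 [a1 [a2 a3]]] [a4 [a5 [a6 a7]]]].
      destruct (Fb (x, y)) as [[b0 [b1 [b2 b3]]] [b4 [b5 [b6 b7]]]].
      apply (f_equal HCscalar) in H5. unfold HCscalar, Re, Im in *; simpl in *.
      unfold plus, minus, opp, zero in H5; simpl in H5.
      unfold plus, minus, opp, zero in H5; simpl in H5. injection H5 as E1 E2.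
      split; lra. }
    destruct E as [E1 E2]. unfold Re, Im, HCscalar in E1, E2; simpl in E1, E2.
    apply differentiable_Cder; apply filterdiff_differentiable_pt_lim.
    + pose proof (is_derive_filterdiff (fun a b => Re (HCscalar (F (a, b)))) x y
        (fun a b => Re (HCscalar (Fa (a, b)))) (Re (HCscalar (Fb (x, y))))) as K.
      eapply filterdiff_ext_lin; [apply K|].
      * generalize L. apply filter_imp. intros [a b] Hab. destruct (H a b Hab) as [G1 _].
        exact (is_derive_fst _ _ _ (is_derive_fst _ _ _ G1)).
      * exact (is_derive_fst _ _ _ (is_derive_fst _ _ _ H2)).
      * apply (continuous_ext (fun u => Re (HCscalar (Fa u)))); [now intros [a b]|].
        apply (continuous_fst_comp (fun u => fst (Fa u))), continuous_fst_comp, H3.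
      * intros [a b]; simpl. rewrite E2. unfold plus, scal, mult; simpl; unfold mult; simpl. ring.
    + pose proof (is_derive_filterdiff (fun a b => Im (HCscalar (F (a, b)))) x y
        (fun a b => Im (HCscalar (Fa (a, b)))) (Im (HCscalar (Fb (x, y))))) as K.
      eapply filterdiff_ext_lin; [apply K|].
      * generalize L. apply filter_imp. intros [a b] Hab. destruct (H a b Hab) as [G1 _].
        exact (is_derive_fst _ _ _ (is_derive_snd _ _ _ G1)).
      * exact (is_derive_fst _ _ _ (is_derive_snd _ _ _ H2)).
      * apply (continuous_ext (fun u => Im (HCscalar (Fa u)))); [now intros [a b]|].
        apply (continuous_fst_comp (fun u => snd (Fa u))), continuous_snd_comp, H3.
      * intros [a b]; simpl. rewrite E1. unfold plus, scal, mult; simpl; unfold mult; simpl. ring.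
  - intros [x y] Hz. destruct (H x y (HD _ Hz)) as [_ [_ [H3 _]]].
    apply continuous_pair_iff; split; simpl.
    + apply (continuous_fst_comp (fun u => fst (Fa u))), continuous_fst_comp, H3.
    + apply (continuous_fst_comp (fun u => snd (Fa u))), continuous_snd_comp, H3.
Qed.

(** * Divisibility of the symmetrization *)

Definition HCembed (z : C) : HC := (qreal (fst z), qreal (snd z)).

Lemma HCembed_mult (z w : C) : HCmul (HCembed z) (HCembed w) = HCembed (z * w)%C.
Proof. unfold HCembed, HCmul, qreal; destruct z, w. quat_eq; ring. Qed.

Lemma HCembed_pow (z : C) (n : nat) : HCpow (HCembed z) n = HCembed (Cpow z n).
Proof.
  induction n as [|n IH]; simpl.
  - reflexivity.
  - now rewrite IH, HCembed_mult.
Qed.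

(** Taking the scalar part is linear over the embedded complex numbers, so an identity of stem
    functions with a real factor descends to C even when the cofactor is not real. *)
Lemma HCscalar_mult (z : C) (G : HC) : HCscalar (HCmul (HCembed z) G) = (z * HCscalar G)%C.
Proof.
  destruct z, G as [[a0 [a1 [a2 a3]]] [a4 [a5 [a6 a7]]]].
  unfold HCscalar, HCembed, HCmul, qreal. quat_eq; ring.
Qed.

(** (x - q)^s = x^2 - 2 alpha x + alpha^2 + beta^2 depends only on the sphere of q, and its complex
    roots are alpha + i beta and its conjugate. *)
Lemma symm_linear_stem (alpha beta : R) (I : quat) (z : C) :
  imag_unit I ->
  symm_stem (linear_stem (slice_point alpha I beta)) z =
    HCembed ((z - (alpha, beta)) * (z - Cconj (alpha, beta)))%C.
Proof.
  destruct I as [a [b [c d]]]. intros HI. apply imag_unit_iff in HI. destruct HI as [-> HI].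
  rewrite slice_point_eq. destruct z as [x y].
  unfold symm_stem, linear_stem, HCembed, HCmul, qreal. quat_eq; try ring.
  transitivity ((x - alpha) * (x - alpha) - y * y + beta * beta * (b * b + c * c + d * d)); [ring|].
  rewrite HI. ring.
Qed.

(** For real F the stem function of f^s is F^2. Each power of (x - q)^s yields a factor at both
    conjugate points, so either point can take the other's factors into its cofactor. *)
Lemma symm_divides (D : C -> Prop) (f : quat -> quat) (r alpha beta : R) (I : quat) (n : nat) :
  slice_preserving D f -> (forall z, Cmod z < r -> D z) -> imag_unit I ->
  symm_power_divides D f (slice_point alpha I beta) n ->
  divides r (alpha, beta) n (fun z => slice_repr f z * slice_repr f z)%C /\
  divides r (Cconj (alpha, beta)) n (fun z => slice_repr f z * slice_repr f z)%C.
Proof.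
  intros Hp HD HI [F [G [_ [HF [_ [HG H]]]]]].
  pose proof (Hol_stem D G r HG HD) as HolG.
  assert (E : forall z, Cmod z < r -> (slice_repr f z * slice_repr f z =
     Cpow (z - (alpha, beta)) n * (Cpow (z - Cconj (alpha, beta)) n * HCscalar (G z)))%C).
  { intros z Hz. pose proof (H z (HD z Hz)) as E.
    rewrite symm_linear_stem, HCembed_pow in E by auto.
    apply (f_equal HCscalar) in E. rewrite HCscalar_mult, Cpow_mult_l in E.
    rewrite Cmult_assoc, <- E. unfold symm_stem. rewrite (stem_real D f F z) by auto.
    destruct (slice_repr f z). unfold HCscalar, HCmul, qreal. quat_eq; ring. }
  assert (Hlin : forall w, Hol r (fun z => z - w)%C).
  { intros w. apply (Hol_ext r (fun z => - w + 1 * z)%C); [intros; ring | apply Hol_affine]. }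
  split.
  - exists (fun z => Cpow (z - Cconj (alpha, beta)) n * HCscalar (G z))%C. split; auto.
    apply Hol_mult; auto. now apply Hol_pow.
  - exists (fun z => Cpow (z - (alpha, beta)) n * HCscalar (G z))%C. split.
    + apply Hol_mult; auto. now apply Hol_pow.
    + intros z Hz. rewrite (E z Hz). ring.
Qed.

(** * The Laplacian of log |f| at the origin *)

(** log |H (t c)| is the real part of log H (t c); each t-derivative brings out one factor c. *)
Lemma second_derivative_ln_Cmod (r : R) (H : C -> C) (c : C) :
  0 < r -> Hol r H -> H 0 <> RtoC 0 ->
  Derive_n (fun t => ln (Cmod (H (RtoC t * c)%C))) 2 0 = Re (c * c * lam H).
Proof.
  intros Hr HH H0. assert (Hr0 : Cmod 0 < r) by now rewrite Cmod_0.
  assert (Hc : forall t, continuous (fun t => RtoC t * c)%C t).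
  { intros t. apply continuous_Cmult; [apply continuous_RtoC, continuous_id | apply continuous_const]. }
  assert (D : forall t, is_Cderive (fun t => RtoC t * c)%C t c).
  { intros t. destruct (is_Cderive_affine 0 c t) as [A1 A2]. split.
    - apply is_derive_ext with (2 := A1). intros; f_equal; ring.
    - apply is_derive_ext with (2 := A2). intros; f_equal; ring. }
  assert (E0 : (RtoC 0 * c = 0)%C) by ring.
  assert (L : locally (0 : R) (fun t => Cmod (RtoC t * c) < r /\ H (RtoC t * c)%C <> RtoC 0)).
  { apply (Hc 0 (fun z => Cmod z < r /\ H z <> RtoC 0)). rewrite E0.
    apply filter_and.
    - now apply locally_disc.
    - apply locally_neq_0; auto. now apply (Hol_continuous r). }
  change (Derive (Derive (fun t => ln (Cmod (H (RtoC t * c)%C)))) 0 = Re (c * c * lam H)).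
  rewrite (Derive_ext_loc _ (fun t => Re (dlog H (RtoC t * c) * c))).
  - apply is_derive_unique.
    replace (c * c * lam H)%C with (lam H * c * c)%C by ring.
    apply (is_Cderive_scal_r (fun t => dlog H (RtoC t * c)%C) 0).
    apply (Cder_curve (dlog H)); auto. rewrite E0. now apply (dlog_der r).
  - generalize L. apply filter_imp. intros t [Ht Hn]. apply is_derive_unique.
    replace (dlog H (RtoC t * c) * c)%C with (Cd H (RtoC t * c) * c / H (RtoC t * c))%C
      by (unfold dlog; field; auto).
    apply (is_derive_ln_Cmod (fun t => H (RtoC t * c)%C)); auto.
    apply (Cder_curve H); auto. apply HH; auto.
Qed.

Lemma plus_zero_slice (t a b c d alpha beta : R) (I : quat) :
  slice_point alpha I beta = (t * a, (t * b, (t * c, t * d))) ->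
  plus (zero : quat) (scal t ((a, (b, (c, d))) : quat)) = slice_point alpha I beta.
Proof. intros ->. quat_eq; unfold zero; simpl; unfold zero; simpl; ring. Qed.

(** Along the real axis |f| is |F (t)|, and along each of the three imaginary axes it is |F (i t)|.
    The squares of the directions add up to 1 - 3 = -2. *)
Lemma laplacian_slice (D : C -> Prop) (f : quat -> quat) (F : C -> HC) (r : R) :
  induces D F f -> slice_preserving D f -> 0 < r -> (forall z, Cmod z < r -> D z) ->
  Hol r (slice_repr f) -> slice_repr f 0 <> RtoC 0 ->
  laplacian (fun x => ln (qnorm (f x))) zero = - 2 * Re (lam (slice_repr f)).
Proof.
  intros HF Hp Hr HD HH H0. unfold laplacian.
  assert (K : forall (e : quat) (c : C), Cmod c = 1 ->
    (forall t : R, exists I, imag_unit I /\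
        plus (zero : quat) (scal t e) = slice_point (fst (RtoC t * c)%C) I (snd (RtoC t * c)%C)) ->
    Derive_n (fun t : R => ln (qnorm (f (plus (zero : quat) (scal t e))))) 2 0 =
      Re (c * c * lam (slice_repr f))).
  { intros e c Hc He. rewrite <- (second_derivative_ln_Cmod r) by auto.
    apply Derive_n_ext_loc. exists (mkposreal r Hr). intros t Ht.
    assert (Hz : Cmod (RtoC t * c) < r).
    { rewrite Cmod_mult, Hc, Cmod_R, Rmult_1_r.
      unfold ball in Ht; simpl in Ht; unfold AbsRing_ball, abs, minus, plus, opp in Ht; simpl in Ht.
      now replace t with (t + - 0) by ring. }
    destruct (He t) as [I [HI ->]].
    rewrite (slice_norm D f F) by (auto; rewrite <- surjective_pairing; auto).
    now rewrite <- surjective_pairing. }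
  rewrite (K _ (RtoC 1) Cmod_1), !(fun e => K e Ci Cmod_Ci).
  - destruct (lam (slice_repr f)). unfold Re; simpl. ring.
  - intros t; exists qk; split; [apply imag_unit_qk|]. apply plus_zero_slice.
    unfold qk; rewrite slice_point_eq; quat_eq; ring.
  - intros t; exists qj; split; [apply imag_unit_qj|]. apply plus_zero_slice.
    unfold qj; rewrite slice_point_eq; quat_eq; ring.
  - intros t; exists qi; split; [apply imag_unit_qi|]. apply plus_zero_slice.
    unfold qi; rewrite slice_point_eq; quat_eq; ring.
  - intros t; exists qi; split; [apply imag_unit_qi|]. apply plus_zero_slice.
    unfold qi; rewrite slice_point_eq; quat_eq; ring.
Qed.

(* Allowing n = 0 makes every index set nonempty, as [Lub_Rbar] of the empty set is [m_infty]. *)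
Lemma sum_Lub_le {T : Type} (P : T -> nat -> Prop) (l : list T) (B : R) :
  (forall ps : list (T * nat), map fst ps = l ->
     (forall x n, In (x, n) ps -> P x n \/ n = 0%nat) -> INR (list_sum (map snd ps)) <= B) ->
  Rbar_le (fold_right Rbar_plus (Finite 0)
    (map (fun x => Lub_Rbar (fun y => exists n, P x n /\ y = INR n)) l)) B.
Proof.
  revert B. induction l as [|x l IH]; intros B HB; simpl.
  - apply (HB nil); [reflexivity|]. intros ? ? [].
  (* [Rbar_plus] gives p_infty + m_infty the value 0; this bound covers that case. *)
  - assert (H0 : 0 <= B).
    { pose proof (HB (map (fun u => (u, 0%nat)) (x :: l))) as K.
      assert (E : list_sum (map snd (map (fun u : T => (u, 0%nat)) (x :: l))) = 0%nat).
      { clear. induction (x :: l) as [|a m IH]; simpl; auto. }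
      rewrite E in K. apply K.
      - rewrite map_map. apply map_id.
      - intros u n Hu. apply in_map_iff in Hu. destruct Hu as [v [Hv _]]. injection Hv as _ Hv. now right. }
    set (S := fold_right Rbar_plus (Finite 0)
      (map (fun x => Lub_Rbar (fun y => exists n, P x n /\ y = INR n)) l)) in *.
    assert (HS : forall n, P x n \/ n = 0%nat -> Rbar_le S (B - INR n)).
    { intros n Hn. apply IH. intros ps E Hps.
      assert (K : INR (list_sum (map snd ((x, n) :: ps))) <= B).
      { apply HB; [simpl; now rewrite E|].
        intros u k [Hu|Hu]; [injection Hu as <- <-; auto | auto]. }
      simpl in K. rewrite plus_INR in K. lra. }
    pose proof (HS 0%nat (or_intror eq_refl)) as HS0.
    destruct (Lub_Rbar_correct (fun y => exists n, P x n /\ y = INR n)) as [_ Hl].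
    destruct S as [s| |]; simpl in *.
    + specialize (Hl (Finite (B - s))).
      assert (Hx : Rbar_le (Lub_Rbar (fun y => exists n, P x n /\ y = INR n)) (B - s)).
      { apply Hl. intros y [n [Hn ->]]. specialize (HS n (or_introl Hn)). simpl in *. lra. }
      destruct (Lub_Rbar _); simpl in *; auto. lra.
    + easy.
    + destruct (Lub_Rbar _); simpl; auto.
Qed.

(** * Spheres of zeros, maximum modulus and domain *)

Lemma ForallOrdPairs_NoDup_map {T U : Type} (h : T -> U) (Q : T -> T -> Prop) (l : list T) :
  ForallOrdPairs Q l ->
  (forall x y, In x l -> In y l -> h x = h y -> ~ Q x y) -> NoDup (map h l).
Proof.
  intros H. induction H as [|x l Hx Hl IH]; intros HQ; simpl; [constructor|].
  constructor.
  - intros Hin. apply in_map_iff in Hin. destruct Hin as [y [E Hy]].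
    apply (HQ x y); simpl; auto. rewrite Forall_forall in Hx; auto.
  - apply IH. intros u v Hu Hv. apply HQ; simpl; auto.
Qed.

(* The point of the closed upper half plane whose sphere contains x. *)
Definition upper_point (x : quat) : C :=
  (fst x, sqrt (fst (snd x) ^ 2 + fst (snd (snd x)) ^ 2 + snd (snd (snd x)) ^ 2)).

Lemma upper_point_slice (alpha beta : R) (I : quat) :
  imag_unit I -> 0 <= beta -> upper_point (slice_point alpha I beta) = (alpha, beta).
Proof.
  destruct I as [a [b [c d]]]. intros HI Hb. apply imag_unit_iff in HI. destruct HI as [-> HI].
  rewrite slice_point_eq. unfold upper_point; simpl. f_equal; [ring|].
  transitivity (sqrt (Rsqr beta)); [|now apply sqrt_Rsqr]. f_equal. unfold Rsqr.
  transitivity (beta * beta * (b * b + c * c + d * d)); [ring | rewrite HI; ring].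
Qed.

(** The bound B shows that the supremum is finite, so that [real] returns it and not the default 0
    of an infinite value. *)
Lemma max_modulus_ub (f : quat -> quat) (rho B : R) (x : quat) :
  (forall y, qnorm y = rho -> qnorm (f y) <= B) -> qnorm x = rho ->
  qnorm (f x) <= max_modulus f rho.
Proof.
  intros HB Hx. unfold max_modulus.
  destruct (Lub_Rbar_correct (fun y => exists x : quat, qnorm x = rho /\ y = qnorm (f x))) as [H1 H2].
  specialize (H1 (qnorm (f x)) (ex_intro _ x (conj Hx eq_refl))).
  assert (H3 : Rbar_le (Lub_Rbar (fun y => exists x : quat, qnorm x = rho /\ y = qnorm (f x))) B).
  { apply H2. intros y [u [Hu ->]]. now apply HB. }
  destruct (Lub_Rbar _); simpl in *; easy.
Qed.

Lemma quat_slice (x : quat) :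
  exists alpha beta I, imag_unit I /\ x = slice_point alpha I beta.
Proof.
  destruct x as [a [b [c d]]]. set (n := sqrt (b * b + c * c + d * d)).
  assert (Hn : n * n = b * b + c * c + d * d) by (apply sqrt_sqrt; nra).
  destruct (Req_dec n 0) as [E|Hn0].
  - exists a, 0, qi. split; [apply imag_unit_qi|].
    rewrite E in Hn. unfold qi; rewrite slice_point_eq.
    assert (b = 0) by nra. assert (c = 0) by nra. assert (d = 0) by nra. subst. quat_eq; ring.
  - exists a, n, (0, (b / n, (c / n, d / n))). split.
    + apply imag_unit_iff. split; auto.
      replace (b / n * (b / n) + c / n * (c / n) + d / n * (d / n))
        with ((b * b + c * c + d * d) / (n * n)) by (field; auto).
      rewrite <- Hn. field; auto.
    + rewrite slice_point_eq. quat_eq; field; auto.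
Qed.

(** Continuity bounds g on one circle of radius p between s and r, and Cauchy's formula, with a
    kernel of modulus at most p / (p - s), carries the bound inside. *)
Lemma Hol_bounded (r s : R) (g : C -> C) :
  Hol r g -> 0 < s < r -> exists B, forall z, Cmod z <= s -> Cmod (g z) <= B.
Proof.
  intros Hg Hs. set (p := (s + r) / 2).
  assert (Cc : forall th, continuous (fun th => g (RtoC p * cis th)%C) th).
  { intros th. apply (continuous_comp (fun th => RtoC p * cis th)%C g); [apply continuous_circle|].
    apply (Hol_continuous r); auto. rewrite Cmod_circle; unfold p; lra. }
  destruct (bounded_on_period _ Cc) as [B [HB Hb]].
  exists (B * (p / (p - s))). intros z Hz.
  assert (Hp : s < p < r) by (unfold p; lra).
  rewrite (Cauchy_formula r p g z Hg) by lra.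
  assert (N : forall th, (RtoC p * cis th - z)%C <> RtoC 0) by (intros; apply circle_minus_neq_0; lra).
  apply Cmod_Cmean_le.
  - intros th. apply continuous_Cmult; auto. apply continuous_Cdiv; auto.
    + apply continuous_circle.
    + apply continuous_Cminus; [apply continuous_circle | apply continuous_const].
  - intros th Hth. rewrite Cmod_mult, Cmod_div, Cmod_circle by (auto; lra).
    apply Rmult_le_compat; auto; try apply Cmod_ge_0.
    + apply Rdiv_le_0_compat; [lra|]. now apply Cmod_gt_0.
    + apply Rmult_le_compat_l; [lra|]. apply Rinv_le_contravar; [lra|].
      apply Rle_trans with (2 := Cmod_triangle_rev _ _). rewrite Cmod_circle; lra.
Qed.

(** A quaternion determines the pair (alpha, beta) only up to the sign of beta; the symmetry of D
    absorbs the ambiguity. *)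
Lemma closed_disc_in_domain (D : C -> Prop) (rho : R) (z : C) :
  conj_symmetric D -> (forall x, qnorm x <= rho -> Omega D x) -> Cmod z <= rho -> D z.
Proof.
  intros Hs HD Hz. destruct z as [x y].
  destruct (HD (slice_point x qi y)) as [a [b [I [Hab [HI E]]]]].
  { now rewrite qnorm_slice_point by apply imag_unit_qi. }
  destruct I as [i0 [i1 [i2 i3]]]. apply imag_unit_iff in HI. destruct HI as [-> HI].
  unfold qi in E. rewrite !slice_point_eq in E. injection E as E1 E2 E3 E4.
  assert (Hy : y * y = b * b).
  { transitivity (b * b * (i1 * i1 + i2 * i2 + i3 * i3)); [|rewrite HI; ring].
    assert (b * i2 = 0) by lra. assert (b * i3 = 0) by lra. assert (y = b * i1) by lra.
    subst y. transitivity (b * i1 * (b * i1) + b * i2 * (b * i2) + b * i3 * (b * i3)); [|ring].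
    rewrite H, H0. ring. }
  assert (Hx : x = a) by lra. subst a.
  assert (Hyb : y = b \/ y = - b).
  { assert (Hm : (y - b) * (y + b) = 0) by lra. apply Rmult_integral in Hm. lra. }
  destruct Hyb as [->| ->]; auto. apply (Hs (x, b)); auto.
Qed.

Theorem corollary3p10 :
  forall (D : C -> Prop) (f : quat -> quat) (rho r : R),
    0 < rho ->
    open D ->
    conj_symmetric D ->
    (forall x : quat, qnorm x <= rho -> Omega D x) ->
    slice_regular D f ->
    slice_preserving D f ->
    f zero <> zero ->
    (forall x : quat, Omega D x -> f x = zero -> cone x) ->
    0 < r < rho ->
    Rbar_le (zero_count D f r)
      (Finite
         ((ln (max_modulus f rho) - ln (qnorm (f zero))
             - 1 / 8 * rho ^ 2 * laplacian (fun x => ln (qnorm (f x))) zero)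
          / (ln rho - ln r))).
Proof.
  intros D f rho r Hrho HDo HDs HDin [F [HF1 [HF2 HF]]] Hp Hf0 Hcone Hr.
  destruct (open_contains_larger_disc D rho Hrho HDo) as [R0 [HR0 HD]].
  { intros z; now apply closed_disc_in_domain. }
  assert (HH : Hol R0 (slice_repr f)).
  { apply (Hol_ext R0 (fun z => HCscalar (F z))); [|now apply (Hol_stem D)].
    intros z Hz. rewrite (stem_real D f F z) by auto. destruct (slice_repr f z).
    reflexivity. }
  assert (Hzero : zero = slice_point 0 qi 0).
  { unfold qi; rewrite slice_point_eq. quat_eq; unfold zero; simpl; unfold zero; simpl; ring. }
  assert (Cz : Cmod 0 < R0) by (rewrite Cmod_0; lra).
  assert (Hfz : forall x y I, D (x, y) -> imag_unit I ->
     (f (slice_point x I y) = zero <-> slice_repr f (x, y) = 0)).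
  { intros x y I Hxy HI. destruct I as [i0 [i1 [i2 i3]]].
    rewrite (slice_value D f F) by auto. apply imag_unit_iff in HI. destruct HI as [-> HI].
    destruct (slice_repr f (x, y)) as [u v]; simpl. split.
    - intros E. injection E as E1 E2 E3 E4.
      unfold zero in E1, E2, E3, E4; simpl in E1, E2, E3, E4.
      assert (v * v = 0).
      { transitivity (v * v * (i1 * i1 + i2 * i2 + i3 * i3)); [rewrite HI; ring|].
        transitivity (v * i1 * (v * i1) + v * i2 * (v * i2) + v * i3 * (v * i3)); [ring|].
        rewrite E2, E3, E4. ring. }
      apply injective_projections; simpl; nra.
    - intros E. injection E as -> ->. quat_eq; unfold zero; simpl; unfold zero; simpl; ring. }
  assert (H0 : slice_repr f 0 <> RtoC 0).
  { intros E. apply Hf0. apply (proj2 (Hfz 0 0 qi (HD _ Cz) imag_unit_qi)) in E. rewrite <- Hzero in E. exact E. }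
  rewrite (laplacian_slice D f F R0) by (auto; lra).
  rewrite Hzero, (slice_norm D f F) by (auto using imag_unit_qi; now apply HD).
  set (M := max_modulus f rho).
  assert (HM : forall z, Cmod z = rho -> Cmod (slice_repr f z) <= M).
  { destruct (Hol_bounded R0 rho (slice_repr f) HH ltac:(lra)) as [B HB].
    intros [x y] Hz. rewrite <- (slice_norm D f F x y qi); auto using imag_unit_qi.
    2: { apply HD. lra. }
    apply max_modulus_ub with B.
    - intros q Hq. destruct (quat_slice q) as [a [b [I [HI ->]]]].
      rewrite qnorm_slice_point in Hq by auto.
      rewrite (slice_norm D f F) by (auto; apply HD; lra). apply HB; lra.
    - rewrite qnorm_slice_point by apply imag_unit_qi. auto. }
  assert (HM0 : 0 < M).
  { apply Rlt_le_trans with (Cmod (slice_repr f 0)); [now apply Cmod_gt_0|].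
    apply (maximum_principle R0 rho M (slice_repr f) 0 HH); auto. rewrite Cmod_0; lra. }
  (* The stem function of f^s, in which the multiplicities are measured. *)
  set (H := fun z => (slice_repr f z * slice_repr f z)%C).
  assert (HolH : Hol R0 H) by now apply Hol_mult.
  assert (HH0 : H 0 <> RtoC 0) by now apply Cmult_neq_0.
  assert (Hlam : lam H = (lam (slice_repr f) + lam (slice_repr f))%C).
  { apply (lam_mult R0); auto; lra. }
  assert (HcH : zeros_in_cone rho H).
  { intros [x y] Hz E.
    assert (Hxy : D (x, y)) by (apply HD; lra).
    assert (Ez : slice_repr f (x, y) = 0).
    { destruct (Ceq_dec (slice_repr f (x, y)) 0) as [|N]; auto.
      exfalso. revert E. now apply Cmult_neq_0. }
    apply (Hfz x y qi Hxy imag_unit_qi) in Ez.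
    destruct (Hcone (slice_point x qi y)) as [a [b [I [HI [Hab [Hb E2]]]]]]; auto.
    { exists x, y, qi; auto using imag_unit_qi. }
    destruct I as [i0 [i1 [i2 i3]]]. apply imag_unit_iff in HI. destruct HI as [-> HI].
    unfold qi in E2. rewrite !slice_point_eq in E2. injection E2 as E3 E4 E5 E6.
    assert (Hy : y * y = b * b).
    { transitivity (b * b * (i1 * i1 + i2 * i2 + i3 * i3)); [|rewrite HI; ring].
      transitivity (b * i1 * (b * i1) + b * i2 * (b * i2) + b * i3 * (b * i3)); [|ring].
      rewrite <- E4, <- E5, <- E6. ring. }
    assert (Hx : x = a) by lra. unfold Re; simpl. rewrite Hy, Hx.
    apply Rabs_le_between in Hab. nra. }
  assert (Hln : 0 < ln rho - ln r) by (pose proof (ln_increasing r rho); lra).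
  unfold zero_count, Rbar_lub. destruct (Rbar_ex_lub _) as [N [HU HN]]; simpl proj1_sig.
  apply HN. intros y [l [[Hl Hpairs] ->]].
  assert (Hgood : forall x, In x l -> exists a b I, imag_unit I /\ 0 < b /\ x = slice_point a I b /\
     upper_point x = (a, b) /\ Cmod (a, b) < r).
  { intros x Hx. destruct (Hl x Hx) as [HO [Hq Ex]].
    destruct (Hcone x HO Ex) as [a [b [I [HI [Hab [Hb ->]]]]]].
    assert (Hb' : 0 < b) by (pose proof (Rabs_pos a); lra).
    exists a, b, I. repeat split; auto.
    - apply upper_point_slice; auto; lra.
    - now rewrite qnorm_slice_point in Hq. }
  apply sum_Lub_le. intros ps Eps Hps.
  (* Each sphere enters through both its points in the slice. They differ because [b] is positive:
     beta >= |alpha| and beta <> 0 exclude the real axis. *)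
  set (L := map (fun p => (upper_point (fst p), snd p)) ps ++
            map (fun p => (Cconj (upper_point (fst p)), snd p)) ps).
  assert (HL : INR (list_sum (map snd L)) = 2 * INR (list_sum (map snd ps))).
  { unfold L. rewrite map_app, list_sum_app, plus_INR, !map_map. simpl.
    change (fun x : quat * nat => snd x) with (@snd quat nat). ring. }
  pose proof (zero_count_bound R0 rho r (M * M) L H) as K.
  rewrite HL, Hlam in K.
  assert (K' : 2 * INR (list_sum (map snd ps)) * (ln rho - ln r) <=
     ln (M * M) - ln (Cmod (H 0)) + rho ^ 2 / 4 * Re (lam (slice_repr f) + lam (slice_repr f))).
  { apply K; auto.
    - unfold L. rewrite map_app, !map_map. simpl.
      replace (map (fun x : quat * nat => upper_point (fst x)) ps) with (map upper_point l)
        by (rewrite <- Eps, map_map; reflexivity).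
      replace (map (fun x : quat * nat => Cconj (upper_point (fst x))) ps)
        with (map Cconj (map upper_point l)) by (rewrite <- Eps, !map_map; reflexivity).
      assert (Hnd : NoDup (map upper_point l)).
      { apply (ForallOrdPairs_NoDup_map upper_point _ l Hpairs). intros x y Hx Hy E.
        destruct (Hgood x Hx) as [a [b [I [HI [_ [Ex [Ux _]]]]]]].
        destruct (Hgood y Hy) as [a' [b' [J [HJ [_ [Ey [Uy _]]]]]]].
        rewrite Ux, Uy in E. injection E as -> ->. intros Hn. apply Hn.
        exists a', b', I, J; auto. }
      apply NoDup_app; auto.
      + apply Injective_map_NoDup; auto. intros u v E.
        rewrite <- (Cconj_conj u), E. apply Cconj_conj.
      + intros z Hz1 Hz2. apply in_map_iff in Hz1. destruct Hz1 as [x [<- Hx]].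
        apply in_map_iff in Hz2. destruct Hz2 as [w [Ew Hw]].
        apply in_map_iff in Hw. destruct Hw as [y [<- Hy]].
        destruct (Hgood x Hx) as [a [b [I [_ [Hb [_ [Ux _]]]]]]].
        destruct (Hgood y Hy) as [a' [b' [J [_ [Hb' [_ [Uy _]]]]]]].
        rewrite Ux, Uy in Ew. injection Ew as E1 E2. lra.
    - assert (Hdiv : forall x n, In (x, n) ps -> Cmod (upper_point x) < r /\
        divides R0 (upper_point x) n H /\ divides R0 (Cconj (upper_point x)) n H).
      { intros x n Hin.
        assert (Hx : In x l) by (rewrite <- Eps; apply (in_map fst _ _ Hin)).
        destruct (Hgood x Hx) as [a [b [I [HI [_ [Ex [Ux Hlt]]]]]]]. rewrite Ux. split; auto.
        destruct (Hps x n Hin) as [Hd| ->].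
        - rewrite Ex in Hd. now apply (symm_divides D f R0 a b I n).
        - split; exists H; split; auto; intros z _; simpl; ring. }
      intros v m Hin. unfold L in Hin. apply in_app_or in Hin.
      destruct Hin as [Hin|Hin]; apply in_map_iff in Hin; destruct Hin as [[x n] [E Hin]];
      injection E as <- <-; destruct (Hdiv x n Hin) as [A1 [A2 A3]]; split; auto.
      simpl. now rewrite Cmod_conj.
    - intros z Hz. unfold H. rewrite Cmod_mult. apply Rmult_le_compat; auto; apply Cmod_ge_0. }
  (* Every term of [K'] is twice the wanted one, and rho^2 / 4 is - 1/8 rho^2 times the - 2 from the
     Laplacian. *)
  unfold H in K'. rewrite Cmod_mult in K'.
  pose proof (proj1 (Cmod_gt_0 _) H0) as Hp0.
  rewrite !ln_mult in K' by auto.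
  unfold Rbar_le. apply Rmult_le_reg_r with (ln rho - ln r); auto.
  unfold Rdiv at 1. rewrite Rmult_assoc, Rinv_l, Rmult_1_r by lra.
  change (0, 0) with (RtoC 0).
  replace (Re (lam (slice_repr f) + lam (slice_repr f))) with (2 * Re (lam (slice_repr f))) in K'
    by (unfold Re; simpl; ring).
  lra.
Qed.
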